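(* There exists a constant $C>0$ such that for every integer $g\ge 3$ and every planar graph $G$ of minimum degree at least $2$ and girth at least $g$, one has $|\operatorname{fdom}(G)-3|\le C/g$; that is, $\operatorname{fdom}(G)=3-O(1/g)$ as $g\to\infty$.
   Context: All graphs are finite and simple. $N[v]$ denotes the closed neighbourhood of $v$. For integers $0<q\le p$, a dominating $(p:q)$-colouring of a graph $G$ is a map $\phi\colon V(G)\to\binom{[p]}{q}$ such that $\bigcup_{u\in N[v]}\phi(u)=[p]$ for every $v\in V(G)$. The fractional domatic number $\operatorname{fdom}(G)$ is the maximum of $p/q$ over all dominating $(p:q)$-colourings of $G$ (equivalently, the LP-relaxation of the maximum number of pairwise disjoint dominating sets). *)

(* Defs.v *)
From HB Require Import structures.
From mathcomp Require Import all_boot all_order all_algebra.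
From mathcomp Require Import all_classical all_reals all_analysis.
Import Order.TTheory GRing.Theory Num.Theory.
Import numFieldNormedType.Exports.

Set Implicit Arguments.
Unset Strict Implicit.
Unset Printing Implicit Defensive.

Local Open Scope classical_set_scope.
Local Open Scope ring_scope.

Record sgraph := SGraph {
  vertex :> finType;
  adj : rel vertex;
  adj_sym : symmetric adj;
  adj_irr : irreflexive adj }.

Definition nbhd (G : sgraph) (v : G) : {set G} := [set u | adj v u]%SET.

Definition cnbhd (G : sgraph) (v : G) : {set G} := (v |: nbhd v)%SET.

(* The vertex set is required to be nonempty: the minimum degree of the graph
   without vertices is undefined. *)
Definition min_degree_geq (G : sgraph) (d : nat) : Prop :=
  (0 < #|G|)%N /\ forall v : G, (d <= #|nbhd v|)%N.

(* Cycles of a simple graph are its closed walks through at least three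
   vertices, without repetition. An acyclic graph has infinite girth. *)
Definition girth_geq (G : sgraph) (g : nat) : Prop :=
  forall c : seq G, (2 < size c)%N -> ucycle (@adj G) c -> (g <= size c)%N.

Definition is_arc (R : realType) (a b : R * R) (A : set (R * R)) : Prop :=
  exists f : R -> R * R,
    [/\ {within `[0, 1], continuous f},
        {in `[0, 1] &, injective f},
        f 0 = a, f 1 = b & A = f @` `[0, 1]].

(* An injective placement [pos] of the vertices in the plane, with every edge
   xy drawn as an arc [E x y] (one arc for both orientations of the edge) whose
   interior contains no vertex and no point of any other edge. *)
Definition plane_drawing (R : realType) (G : sgraph)
    (pos : G -> R * R) (E : G -> G -> set (R * R)) : Prop :=
  let interior x y := E x y `\` [set pos x; pos y] in
  [/\ injective pos,
      (forall x y, adj x y -> is_arc (pos x) (pos y) (E x y)),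
      (forall x y, adj x y -> E x y = E y x),
      (forall x y z, adj x y -> ~ interior x y (pos z)) &
      (forall x y u v, adj x y -> adj u v ->
         [set x; y]%SET <> [set u; v]%SET :> {set G} ->
         interior x y `&` E u v = set0)].

Definition planar (R : realType) (G : sgraph) : Prop :=
  exists (pos : G -> R * R) (E : G -> G -> set (R * R)), plane_drawing pos E.

Definition dominating_colouring (G : sgraph) (p q : nat)
    (phi : G -> {set 'I_p}) : Prop :=
  [/\ (0 < q <= p)%N,
      (forall v, #|phi v| = q) &
      (forall v, (\bigcup_(u in cnbhd v) phi u)%SET = [set: 'I_p]%SET)].

Definition domatic_ratios (R : realType) (G : sgraph) : set R :=
  [set r : R | exists (p q : nat) (phi : G -> {set 'I_p}),
     dominating_colouring q phi /\ r = p%:R / q%:R].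
Arguments domatic_ratios : clear implicits.

(* The supremum is finite when G has a vertex (domatic_ratios_has_sup), and is
   the maximum (fdom_max): it is attained, being the value of a linear program
   with rational data. *)
Definition fdom (R : realType) (G : sgraph) : R := sup (domatic_ratios R G).
Arguments fdom : clear implicits.

Lemma domatic_ratios_has_sup (R : realType) (G : sgraph) :
  (0 < #|G|)%N -> has_sup (domatic_ratios R G).
Proof.
move=> /card_gt0P[v _]; split.
  exists 1, 1%N, 1%N, (fun=> finset.setT); split; last by rewrite divr1.
  split=> // [w|w]; first by rewrite cardsT card_ord.
  apply/eqP; rewrite finset.eqEsubset finset.subsetT /=.
  by apply: (@finset.bigcup_sup _ _ w); rewrite finset.setU11.
exists #|cnbhd v|%:R => _ [p [q [phi [[/andP[q0 _] phiq dom] ->]]]].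
rewrite ler_pdivrMr ?ltr0n// -natrM ler_nat.
rewrite -{1}(card_ord p) -cardsT -(dom v) -sum_nat_const.
elim/big_ind2: _ => [|m A n B Am Bn|u _]; first by rewrite finset.cards0.
  by rewrite (leq_trans (leq_of_leqif (finset.leq_card_setU A B))) ?leq_add.
by rewrite phiq.
Qed.

Lemma fdom_max (R : realType) (G : sgraph) (m : R) :
  domatic_ratios R G m -> ubound (domatic_ratios R G) m -> fdom R G = m.
Proof.
move=> Gm ubm; apply/eqP; rewrite eq_le; apply/andP; split.
  by apply: ge_sup => //; exists m.
by apply: ub_le_sup => //; exists m.
Qed.

(* Main.v *)
(* Large girth and minimum degree at least 2 force, in the absence of a K_5
   minor, a long thread, that is a path of vertices of degree 2.  Otherwise the
   balls of radius linear in the length of the threads are trees with many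
   vertices of degree at least 3; contracting disjoint trees of this kind gives
   a graph of large minimum degree (no two edges join the same trees, by the
   girth condition), which has a K_5 minor by the argument of Mader.  A planar
   graph has no K_5 minor: in any drawing of K_5 by polygonal curves in general
   position, the number of crossings between disjoint edges is odd, because it
   does not change when a curve is replaced with a segment; crossings of curves
   with a common end play no role, which is why a minor does as well as a
   subgraph.
   A colouring with 3k-1 colours, each vertex having k of them, is then built
   by induction: remove the inner vertices of a thread of 18k vertices (or a
   vertex of degree at most 1), colour the rest, and interpolate.  Along a
   thread the colours are almost 3-periodic, and as the 3k-1 colours leave one
   free place they can be rearranged one at a time, like the tiles of a sliding
   puzzle.  Finally k is of order g, and a vertex of degree 2 gives fdom <= 3. *)
Require Import Defs.
From mathcomp Require Import all_boot.
From mathcomp Require Import zify.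
Set Implicit Arguments.
Unset Strict Implicit.
Unset Printing Implicit Defensive.

(** * Clique minors *)

(** Statements about graphs are relative to a vertex set [S], because the induction deletes
    vertices: girth and the absence of a K_5 minor pass to subsets, minimum degree does not, whence
    the separate treatment of leaves. A leaf must have colours disjoint from those of its neighbour:
    two disjoint [k]-sets are two consecutive states of a 3-periodic pattern, hence boundary data
    for the interpolation along a thread. Constants: a misplaced colour costs at most two moves of
    three times each, and there are fewer than [3 * k] colours, whence [18 * k]; average degree
    [32 = 2 ^ 5] suffices for a K_5 minor; a second edge between two clusters of radius [64 * l]
    would close a cycle of at most [256 * l + 2] vertices. In the topological part, compactness
    separates disjoint arcs uniformly and replaces each by a fine chain of points; after a
    perturbation only signs of determinants matter, and parity of crossings becomes a finite boolean
    check. *)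

Definition deg_in (T : finType) (e : rel T) (S : {set T}) (x : T) : nat :=
  #|[set y in S | e x y]|.

Definition restr (T : finType) (e : rel T) (S : {set T}) : rel T :=
  [rel x y | [&& x \in S, y \in S & e x y]].

Definition connected_in (T : finType) (e : rel T) (S : {set T}) : Prop :=
  {in S &, forall x y, connect (restr e S) x y}.

(** Branch sets are indexed by [nat] and constrained only below [t], so that one more can be added
    without changing the index type. *)
Definition clique_minor (T : finType) (e : rel T) (S : {set T}) (t : nat) :=
  exists B : nat -> {set T},
    [/\ forall i, i < t -> [/\ B i \subset S, B i != set0 & connected_in e (B i)],
        forall i j, i < t -> j < t -> i != j -> [disjoint B i & B j] &
        forall i j, i < t -> j < t -> i != j ->
          exists x y, [/\ x \in B i, y \in B j & e x y]].

Lemma restr_sub (T : finType) (e : rel T) (A B : {set T}) :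
  A \subset B -> subrel (connect (restr e A)) (connect (restr e B)).
Proof.
move=> AB; apply: connect_sub => x y /and3P[xA yA xy].
by apply: connect1; rewrite /restr /= !(subsetP AB) // xy.
Qed.

Lemma restr_sym (T : finType) (e : rel T) (A : {set T}) :
  symmetric e -> symmetric (restr e A).
Proof. by move=> es x y; rewrite /restr /= es andbCA. Qed.

Lemma clique_minor_sub (T : finType) (e : rel T) (A B : {set T}) t :
  A \subset B -> clique_minor e A t -> clique_minor e B t.
Proof.
move=> AB [F [F1 F2 F3]]; exists F; split=> // i it.
by have [FA ? ?] := F1 i it; split=> //; apply: subset_trans AB.
Qed.

(** Preimages of branch sets are branch sets: a path of [e'] lifts edge by edge, and the pieces are
    joined inside the connected fibres. Used for a single contracted edge and for the contraction of
    all clusters at once. *)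
Lemma clique_minor_quotient (T T' : finType) (e : rel T) (e' : rel T')
    (S : {set T}) (S' : {set T'}) (f : T -> T') t :
  {in S', forall z, [set x in S | f x == z] != set0} ->
  {in S', forall z, connected_in e [set x in S | f x == z]} ->
  {in S' &, forall z w, e' z w ->
     exists x y, [/\ x \in S, y \in S, f x = z, f y = w & e x y]} ->
  clique_minor e' S' t -> clique_minor e S t.
Proof.
move=> F0 Fc Fe [B [B1 B2 B3]].
exists (fun i => [set x in S | f x \in B i]); split.
- move=> i it; have [BS B0 Bc] := B1 i it; split.
  + by apply/subsetP => x; rewrite inE => /andP[].
  + have /set0Pn[z zB] := B0; have /set0Pn[x] := F0 z (subsetP BS z zB).
    by rewrite inE => /andP[xS /eqP fx]; apply/set0Pn; exists x; rewrite inE xS fx.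
  + have fibre z x y : z \in B i -> x \in S -> y \in S -> f x = z -> f y = z ->
      connect (restr e [set x in S | f x \in B i]) x y.
      move=> zB xS yS fx fy; have zS := subsetP BS z zB.
      apply: (@restr_sub _ _ [set x in S | f x == z]).
        by apply/subsetP => u; rewrite !inE => /andP[-> /eqP->].
      by apply: Fc => //; rewrite inE ?xS ?yS ?fx ?fy eqxx.
    move=> x y; rewrite !inE => /andP[xS xB] /andP[yS yB].
    have /connectP[p] := Bc _ _ xB yB.
    elim: p x xS xB => [|z p IH] x xS xB /=; first by move=> _ fyx; apply: (fibre (f x)).
    case/andP=> /and3P[_ zB xz] pz lz.
    have [u [v [uS vS fu fv uv]]] := Fe _ _ (subsetP BS _ xB) (subsetP BS _ zB) xz.
    apply: (connect_trans (fibre _ _ _ xB xS uS erefl fu)).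
    apply: (connect_trans (y := v)); last by apply: IH; rewrite ?fv.
    by apply: connect1; rewrite /restr /= !inE uS vS fu fv xB zB.
- move=> i j it jt ij; have := B2 i j it jt ij.
  rewrite !disjoint_subset => /subsetP Bij; apply/subsetP => x.
  by rewrite !inE => /andP[_ /Bij]; rewrite !inE negb_and => ->; rewrite orbT.
- move=> i j it jt ij; have [z [w [zB wB zw]]] := B3 i j it jt ij.
  have [BSi _ _] := B1 i it; have [BSj _ _] := B1 j jt.
  have [u [v [uS vS fu fv uv]]] := Fe _ _ (subsetP BSi _ zB) (subsetP BSj _ wB) zw.
  by exists u, v; rewrite !inE uS vS fu fv.
Qed.

(** The vertex [a] is the additional branch set; the others lie in its neighbourhood, so each is
    adjacent to it. *)
Lemma clique_minor_cone (T : finType) (e : rel T) (S : {set T}) a t :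
  symmetric e -> irreflexive e -> a \in S ->
  clique_minor e [set y in S | e a y] t -> clique_minor e S t.+1.
Proof.
move=> es ei aS [B [B1 B2 B3]].
have BN i x : i < t -> x \in B i -> (x \in S) && e a x.
  by move=> it xB; have [/subsetP/(_ x xB)] := B1 i it; rewrite inE.
have aB i : i < t -> a \notin B i.
  by move=> it; apply/negP => /(BN _ _ it); rewrite ei andbF.
exists (fun i => if i < t then B i else [set a]); split.
- move=> i _; case: ifP => it.
    have [BN' ? ?] := B1 i it; split=> //; apply: subset_trans BN' _.
    by apply/subsetP => x; rewrite inE => /andP[].
  split; first by rewrite sub1set.
    by apply/set0Pn; exists a; rewrite inE.
  by move=> x y /set1P-> /set1P->.
- move=> i j; rewrite !ltnS => it jt ij.
  case: ltnP => i1; case: ltnP => j1; first exact: B2.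
  + by rewrite disjoint_sym disjoints1 aB.
  + by rewrite disjoints1 aB.
  + by lia.
- move=> i j; rewrite !ltnS => it jt ij.
  case: ltnP => i1; case: ltnP => j1; first exact: B3.
  + have [_ /set0Pn[x xB] _] := B1 i i1; have /andP[_ ax] := BN _ _ i1 xB.
    by exists x, a; rewrite inE es.
  + have [_ /set0Pn[x xB] _] := B1 j j1; have /andP[_ ax] := BN _ _ j1 xB.
    by exists a, x; rewrite inE.
  + by lia.
Qed.

Lemma sum_deg_in (T : finType) (e : rel T) (S : {set T}) :
  \sum_(x in S) deg_in e S x =
  #|[set u : T * T | [&& u.1 \in S, u.2 \in S & e u.1 u.2]]|.
Proof.
rewrite -sum1_card /deg_in.
under eq_bigr do rewrite -sum1_card.
rewrite pair_big_dep /=; apply: eq_bigl => -[x y] /=.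
by rewrite !inE /=.
Qed.

(** The edge [ab] is contracted onto [a]. The vertex [b] stays in the type, and the relation is used
    on [S :\ b]. *)
Definition contract (T : finType) (e : rel T) (a b : T) : rel T :=
  [rel x y | (x != y) && [|| e x y, (x == a) && e b y | (y == a) && e x b]].

Lemma contract_sym (T : finType) (e : rel T) a b :
  symmetric e -> symmetric (contract e a b).
Proof. by move=> es x y; rewrite /contract /= eq_sym (es y x) (es b x) (es y b) (orbC (_ && e x b)). Qed.

(** Degrees sum to the number of ordered adjacent pairs. Renaming [b] to [a] is injective on the
    pairs outside [bad], which consists of the edge [ab] and, for each common neighbour, its edge to
    [b], in both directions. *)
Lemma sum_deg_contract (T : finType) (e : rel T) (S : {set T}) a b :
  symmetric e -> irreflexive e -> a \in S -> b \in S -> e a b ->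
  \sum_(x in S) deg_in e S x <=
  \sum_(x in S :\ b) deg_in (contract e a b) (S :\ b) x
    + 2 * (#|[set y in S | e a y && e b y]|).+1.
Proof.
move=> es ei aS bS ab; rewrite !sum_deg_in.
have nab : a != b by apply: contraTneq ab => ->; rewrite ei.
set C := [set y in S | e a y && e b y].
set E := [set u | [&& u.1 \in S, _ & _]]; set E' := [set u | [&& u.1 \in S :\ b, _ & _]].
pose bad := [set (a, b); (b, a)] :|: ([set (x, b) | x in C] :|: [set (b, x) | x in C]).
have cbad : #|bad| <= 2 * #|C|.+1.
  rewrite mulnS; apply: leq_trans (leq_card_setU _ _) _; apply: leq_add.
    by apply: leq_trans (leq_card_setU _ _) _; rewrite !cards1.
  apply: leq_trans (leq_card_setU _ _) _.
  by rewrite mul2n -addnn; apply: leq_add; apply: leq_imset_card.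
pose f x := if x == b then a else x.
pose F (u : T * T) := (f u.1, f u.2).
rewrite -(cardsID bad E) addnC; apply: leq_add; last first.
  by apply: leq_trans cbad; apply: subset_leq_card; apply: subsetIr.
have inbad x y : (x, y) \in bad = [|| (x == a) && (y == b), (x == b) && (y == a),
     (x \in C) && (y == b) | (y \in C) && (x == b)].
  rewrite !in_setU !in_set1 !xpair_eqE -orbA; congr [|| _ , _ , _ | _].
    apply/imsetP/andP => [[z zC [-> ->]]|[zC /eqP->]]; first by rewrite eqxx.
    by exists x.
  apply/imsetP/andP => [[z zC [-> ->]]|[zC /eqP->]]; first by rewrite eqxx.
  by exists y.
have good x y : (x, y) \in E :\: bad -> [/\ x \in S, y \in S, e x y,
    x = b -> y != a /\ e a y = false & y = b -> x != a /\ e a x = false].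
  rewrite in_setD inbad !inE /= => /andP[+ /and3P[xS yS xy]].
  rewrite !negb_or => /and4P[n1 n2 n3 n4]; split=> // h.
    by move: n2 n4; rewrite -h eqxx ?inE yS xy !andbT /= => ? /negbTE.
  by move: n1 n3; rewrite -h eqxx ?inE xS (es y) xy !andbT /= => ? /negbTE.
have eb x y : e x y -> x = b -> (y == b) = false.
  by move=> xy xb; apply: contraTF xy => /eqP->; rewrite xb ei.
rewrite -(card_in_imset (f := F)).
  apply: subset_leq_card; apply/subsetP => _ /imsetP[[x y] /good[xS yS xy hx hy] ->].
  have nxy : x != y by apply: contraTneq xy => ->; rewrite ei.
  rewrite !inE /= /f /contract /=; have [xb|xb] := eqVneq x b.
    have [ya _] := hx xb; rewrite (eb _ _ xy xb).
    by rewrite aS yS nab (eq_sym a) ya eqxx -xb xy /= (eq_sym y) nxy orbT.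
  have [yb|yb] := eqVneq y b; last by rewrite xS yS xb yb nxy xy.
  by have [xa _] := hy yb; rewrite xS xb aS nab xa eqxx -yb xy /= !orbT.
move=> [x y] [x' y'] /good[_ _ xy hx hy] /good[_ _ xy' hx' hy'] [] /=; rewrite /f.
have [xb|xb] := eqVneq x b; have [xb'|xb'] := eqVneq x' b.
- by rewrite (eb _ _ xy xb) (eb _ _ xy' xb') xb xb' => _ ->.
- rewrite (eb _ _ xy xb) => ax'; case: eqP => [yb' ya|yb' yy']; have [ya' h] := hx xb.
    by rewrite ya eqxx in ya'.
  by rewrite -yy' -ax' h in xy'.
- rewrite (eb _ _ xy' xb') => ax; case: eqP => [yb ya|yb yy']; have [ya' h] := hx' xb'.
    by rewrite -ya eqxx in ya'.
  by rewrite yy' ax h in xy.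
- move=> exx; subst x'; have [yb|yb] := eqVneq y b; have [yb'|yb'] := eqVneq y' b.
  + by rewrite yb yb'.
  + by move=> ay'; have [_ h] := hy yb; rewrite -ay' in xy'; rewrite es xy' in h.
  + by move=> ay; have [_ h] := hy' yb'; rewrite ay es h in xy.
  + by move=> ->.
Qed.

(* Either an edge with fewer than [2 ^ t] common neighbours can be contracted
   without lowering the average degree, or the neighbourhood of a vertex has
   average degree at least [2 ^ t]. *)
Lemma mader t (T : finType) (e : rel T) (S : {set T}) :
  symmetric e -> irreflexive e -> S != set0 ->
  2 ^ t * #|S| <= \sum_(x in S) deg_in e S x -> clique_minor e S t.
Proof.
elim: t T e S => [|t IHt] T e S es ei S0 dS; first by exists (fun=> set0); split=> ?.
have [n] := ubnP #|S|; elim: n e S es ei S0 dS => // n IHn e S es ei S0 dS Sn.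
have [/exists_inP[a aS /exists_inP[b /andP[bS ab] cab]]|noc] :=
  boolP [exists a in S, exists b in [pred b in S | e a b],
           #|[set y in S | e a y && e b y]| < 2 ^ t].
  have nab : b != a by apply: contraTneq ab => ->; rewrite ei.
  pose f x := if x == b then a else x.
  have cS : #|S| = #|S :\ b|.+1 by rewrite (cardsD1 b S) bS.
  apply: (@clique_minor_quotient _ _ e (contract e a b) S (S :\ b) f).
  - move=> z; rewrite !inE => /andP[zb zS]; apply/set0Pn; exists z.
    by rewrite inE zS /f (negPf zb) eqxx.
  - move=> z; rewrite !inE => /andP[zb zS] x y; rewrite !inE /f.
    case/andP=> xS xz /andP[yS yz].
    have [->|xy] := eqVneq x y; first exact: connect0.
    apply: connect1; rewrite /restr /= !inE /f xS yS xz yz /=.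
    move: xz yz xy; have [->|xb] := eqVneq x b; have [->|yb] := eqVneq y b => //.
    + by move=> /eqP<- /eqP-> _; rewrite es.
    + by move=> /eqP-> /eqP<- _.
    + by move=> /eqP-> /eqP->; rewrite eqxx.
  - move=> z w; rewrite !inE => /andP[zb zS] /andP[wb wS] /andP[zw].
    case/or3P=> [h|/andP[/eqP-> h]|/andP[/eqP-> h]].
    + by exists z, w; rewrite /f (negPf zb) (negPf wb).
    + by exists b, w; rewrite /f (negPf wb) eqxx.
    + by exists z, b; rewrite /f (negPf zb) eqxx.
  apply: IHn.
  - exact: contract_sym.
  - by move=> x; rewrite /contract /= eqxx.
  - by apply/set0Pn; exists a; rewrite !inE eq_sym nab.
  (* With fewer than [2 ^ t] common neighbours at most [2 * 2 ^ t] is lost, which is the drop of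
     [2 ^ t.+1 * #|S|] when [S] loses a vertex. *)
  - have := sum_deg_contract es ei aS bS ab; move: cab dS; rewrite cS expnS.
    set c := #|_|; set s := \sum_(x in S) _; set s' := \sum_(x in S :\ b) _.
    by move: (2 ^ t) #|_| => u v; nia.
  - by move: Sn; rewrite cS; lia.
have [a aS /set0Pn[b]] : exists2 a, a \in S & [set y in S | e a y] != set0.
  apply/exists_inP; apply: contraTT dS => /exists_inPn h.
  rewrite big1 => [|x xS]; first by rewrite -ltnNge muln_gt0 expn_gt0 card_gt0.
  by apply/eqP; rewrite cards_eq0; apply: negbNE; apply: h.
move=> bN; apply: (clique_minor_cone es ei aS); apply: IHt => //.
  by apply/set0Pn; exists b.
(* Inside the neighbourhood of [a], the neighbours of [y] are the common neighbours of the edge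
   [ay]. *)
rewrite mulnC -sum_nat_const; apply: leq_sum => y; rewrite inE => /andP[yS ay].
move/exists_inPn/(_ a aS)/exists_inPn/(_ y): noc; rewrite inE yS ay => /(_ isT).
rewrite -leqNgt /deg_in; congr (_ <= _); apply: eq_card => x.
by rewrite !inE andbA.
Qed.

(** * Threads in graphs of large girth *)

(** The length is only bounded and vertices may repeat, so that walks compose freely; a simple path
    is extracted in [walk_around_edge]. *)
Definition walk (T : Type) (r : rel T) (n : nat) (x y : T) : Prop :=
  exists p, [/\ path r x p, last x p = y & size p <= n].

Lemma walk0 (T : Type) (r : rel T) n (x : T) : walk r n x x.
Proof. by exists [::]. Qed.

Lemma walk1 (T : Type) (r : rel T) (x y : T) : r x y -> walk r 1 x y.
Proof. by move=> xy; exists [:: y]; rewrite /= xy. Qed.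

Lemma walk_trans (T : Type) (r : rel T) m n (x y z : T) :
  walk r m x y -> walk r n y z -> walk r (m + n) x z.
Proof.
move=> [p [rp lp sp]] [q [rq lq sq]]; exists (p ++ q).
by rewrite cat_path last_cat lp rp rq size_cat leq_add.
Qed.

Lemma walk_sym (T : Type) (r : rel T) n (x y : T) :
  symmetric r -> walk r n x y -> walk r n y x.
Proof.
move=> rs [p [rp <- sp]]; exists (rev (belast x p)); split.
- by rewrite rev_path; apply: sub_path rp => u v; rewrite rs.
- by case: p {rp sp} => //= z p; rewrite rev_cons last_rcons.
- by rewrite size_rev size_belast.
Qed.

Lemma walk_sub (T : Type) (r r' : rel T) m n (x y : T) :
  subrel r r' -> m <= n -> walk r m x y -> walk r' n x y.
Proof.
move=> rr mn [p [rp lp sp]]; exists p; split=> //; first exact: sub_path rp.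
exact: leq_trans mn.
Qed.

(** Boolean counterpart of [walk], used to take maximal sets and to search for a least distance. *)
Fixpoint reach (T : finType) (r : rel T) (n : nat) (x y : T) : bool :=
  (x == y) || (if n is m.+1 then [exists z, r x z && reach r m z y] else false).

Lemma reachP (T : finType) (r : rel T) n (x y : T) :
  reflect (walk r n x y) (reach r n x y).
Proof.
apply: (iffP idP).
  elim: n x => [|n IH] x /=; case/orP=> [/eqP->|//]; try exact: walk0.
  by case/existsP=> z /andP[xz /IH]; apply: (@walk_trans _ _ 1); apply: walk1.
case=> p [+ + +]; elim: p n x => [|z p IH] [|n] x //=; rewrite ?ltnS.
- by move=> _ -> _; rewrite eqxx.
- by move=> _ -> _; rewrite eqxx.
- move=> /andP[xz pz] lz sp; apply/orP; right; apply/existsP; exists z.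
  by rewrite xz IH.
Qed.

Definition girth_at_least (T : finType) (e : rel T) (g : nat) : Prop :=
  forall c : seq T, 2 < size c -> ucycle e c -> g <= size c.

(** The walk shortens to a simple path that still avoids the edge [xy]; that edge closes it into a
    cycle with at least 3 and at most [n.+1] vertices. *)
Lemma walk_around_edge (T : finType) (e : rel T) g n (x y : T) :
  symmetric e -> irreflexive e -> girth_at_least e g -> e x y ->
  walk [rel u v | e u v && ~~ ((u == x) && (v == y) || (u == y) && (v == x))]
    n x y ->
  g <= n.+1.
Proof.
move=> es ei eg xy [p [+ + sp]]; case/shortenP=> p' pp' up' sub ly.
have sp' : size p' <= n.
  by apply: leq_trans sp; apply: uniq_leq_size sub; case/andP: up'.
have ep : path e x p' by apply: sub_path pp' => u v /andP[].
have s3 : 2 < size (x :: p').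
  case: p' pp' ly {up' sub sp' ep} => [|z [|? ?]] //=.
    by move=> _ xy'; rewrite xy' ei in xy.
  by move=> /andP[/andP[_ +] _] zy; rewrite zy !eqxx.
have : ucycle e (x :: p') by rewrite /ucycle /= rcons_path ep ly es xy.
by move=> /(eg _ s3) h; apply: leq_trans h _.
Qed.

(** The path is extended at its start by a neighbour other than its second vertex. A return to the
    path would close a cycle of fewer than [g] vertices. *)
Lemma long_path (T : finType) (e : rel T) (S : {set T}) g n z :
  symmetric e -> irreflexive e -> girth_at_least e g ->
  {in S, forall x, 2 <= deg_in e S x} -> z \in S -> n < g ->
  exists x p, [/\ path (restr e S) x p, last x p = z, uniq (x :: p),
    {subset x :: p <= S} & size p = n].
Proof.
move=> es ei eg dS zS; elim: n => [|n IH] ng.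
  by exists z, [::]; split=> // x; rewrite inE => /eqP->.
have {IH} [x [p [pp lp up pS sp]]] := IH (ltnW ng).
have xS : x \in S by rewrite pS ?mem_head.
(* For empty [p] the default value [x] excludes no neighbour, by irreflexivity. *)
have [w wN wp] : exists2 w, w \in [set y in S | e x y] & w != head x p.
  have := dS x xS; rewrite /deg_in (cardsD1 (head x p)) => h.
  have : 0 < #|[set y in S | e x y] :\ head x p| by move: h; case: (_ \in _); lia.
  by case/card_gt0P=> w; rewrite in_setD1 => /andP[? ?]; exists w.
move: wN; rewrite inE => /andP[wS xw].
have nw : w \notin x :: p.
  rewrite inE negb_or; apply/andP; split.
    by apply: contraTneq xw => ->; rewrite ei.
  apply/negP => wip; move: pp up wp sp {lp pS}; case/splitPr: wip => p1 p2.
  move=> pp up wp sp; have up1 : uniq (x :: rcons p1 w).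
    by move: up; rewrite -cat_rcons -cat_cons cat_uniq => /andP[].
  move: pp; rewrite cat_path /= => /and3P[pp1 lw pw].
  have : g <= size (x :: rcons p1 w).
    apply: eg.
      by case: p1 wp {pp1 lw up up1 sp} => [|? ?]; rewrite /= ?eqxx // size_rcons.
    rewrite /ucycle /= !rcons_path last_rcons (es w) xw andbT.
    move: lw => /and3P[_ _ ->]; rewrite andbT; apply/andP; split=> //.
    by apply: sub_path pp1 => u v /and3P[].
  by rewrite /= size_rcons; move: sp ng; rewrite size_cat /=; lia.
exists w, (x :: p); split=> //=.
- by rewrite pp /restr /= wS xS es xw.
- by rewrite nw.
- by move=> y; rewrite inE => /orP[/eqP->//|/pS].
- by rewrite sp.
Qed.

(** [Z] is a maximal set with the separation property; a vertex far from [Z] could be added to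
    it. *)
Lemma separated_net (T : finType) (r : rel T) (S : {set T}) n :
  symmetric r ->
  exists Z : {set T}, [/\ Z \subset S,
    {in Z &, forall x y, x != y -> ~ walk r n x y} &
    {in S, forall v, exists2 z, z \in Z & walk r n v z}].
Proof.
move=> rs.
pose P (A : {set T}) := (A \subset S) &&
  [forall x in A, forall y in A, (x != y) ==> ~~ reach r n x y].
have [Z /maxsetP[/andP[ZS Zsep] Zmax]] : {Z | maxset P Z}.
  apply: ex_maxset; exists set0; rewrite /P sub0set /=.
  by apply/forall_inP => x; rewrite inE.
have sep x y : x \in Z -> y \in Z -> x != y -> ~~ reach r n x y.
  by move=> xZ yZ; move/forall_inP/(_ x xZ)/forall_inP/(_ y yZ)/implyP: Zsep.
exists Z; split=> //.
  by move=> x y xZ yZ /(sep x y xZ yZ)/negP nr /reachP.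
move=> v vS; suff /exists_inP[z zZ /reachP vz] : [exists z in Z, reach r n v z].
  by exists z.
apply: negbNE; apply/negP => /exists_inPn far.
have refl x : reach r n x x by apply/reachP; apply: walk0.
suff vZ : v \in Z by have := far v vZ; rewrite refl.
rewrite -(Zmax (v |: Z)) ?setU11 ?subsetUr // /P subUset sub1set vS ZS /=.
have rsym x y : reach r n x y = reach r n y x.
  by apply/reachP/reachP; apply: walk_sym.
apply/forall_inP => x /setU1P[->|xZ]; apply/forall_inP => y /setU1P[->|yZ];
  apply/implyP => xy.
- by rewrite eqxx in xy.
- exact: far.
- by rewrite rsym far.
- exact: sep.
Qed.

Definition parent_edge (T : finType) (r : rel T) (par : T -> T) : rel T :=
  [rel u w | r u w && ((w == par u) || (u == par w))].

(** [d] is the distance to [Z]; [par] moves to a neighbour with smaller [d] and fixes [Z], so that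
    [N] iterations end in [Z] and define [root]. Forest walks take at most [d v] steps, so the own
    root is at least as near as any other point of [Z]. *)
Lemma parent_forest (T : finType) (r : rel T) (S Z : {set T}) N :
  symmetric r -> (forall x y, r x y -> y \in S) -> Z \subset S ->
  {in S, forall v, exists2 z, z \in Z & walk r N v z} ->
  exists par root : T -> T,
    [/\ {in Z, forall z, par z = z /\ root z = z},
        {in S :\: Z, forall v, r v (par v)},
        {in S, forall v, root v \in Z /\ root (par v) = root v} &
        {in S, forall v n z, z \in Z -> walk r n v z ->
           walk (parent_edge r par) n v (root v)} /\
        {in S, forall v, walk (parent_edge r par) N v (root v)}].
Proof.
move=> rs rS ZS near.
pose P v n := [exists z in Z, reach r n v z].
pose d v := find (P v) (iota 0 N.+1).
have dP v : v \in S -> d v <= N /\ P v (d v).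
  move=> /near[z zZ vz]; have h : has (P v) (iota 0 N.+1).
    apply/hasP; exists N; first by rewrite mem_iota add0n ltnSn.
    by apply/exists_inP; exists z => //; apply/reachP.
  have dN : d v < N.+1 by rewrite -[N.+1](size_iota 0) -has_find.
  by split=> //; have := nth_find 0 h; rewrite nth_iota.
have dmin v n : v \in S -> P v n -> d v <= n.
  move=> vS Pn; rewrite leqNgt; apply/negP => nd; have [dN _] := dP v vS.
  have := before_find 0 nd; rewrite nth_iota ?add0n ?Pn //.
  exact: leq_trans nd (leqW dN).
have d0 v : v \in S -> d v = 0 -> v \in Z.
  move=> vS dv; have [_] := dP v vS; rewrite dv => /exists_inP[z zZ] /=.
  by rewrite orbF => /eqP->.
have dZ z : z \in Z -> d z = 0.
  move=> zZ; apply/eqP; rewrite -leqn0; apply: dmin; first exact: (subsetP ZS).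
  by apply/exists_inP; exists z => //=; rewrite eqxx.
pose par v := if v \in Z then v else odflt v [pick u | r v u && (d u < d v)].
have parP v : v \in S :\: Z -> r v (par v) && (d (par v) < d v).
  rewrite inE => /andP[vZ vS]; rewrite /par (negPf vZ); case: pickP => //= no.
  have [_] := dP v vS; case dv: (d v) => [|k]; first by rewrite d0 in vZ.
  case/exists_inP=> z zZ /orP[/eqP vz|]; first by rewrite vz zZ in vZ.
  case/existsP=> u /andP[vu uz]; have := no u; rewrite vu /= dv ltnS => /negP[].
  by apply: dmin; [apply: rS vu|apply/exists_inP; exists z].
have parZ z : z \in Z -> par z = z by rewrite /par => ->.
have parS v : v \in S -> par v \in S.
  move=> vS; have [vZ|vZ] := boolP (v \in Z); first by rewrite parZ.
  by have /andP[/rS] : r v (par v) && (d (par v) < d v) by apply: parP; rewrite inE vZ.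
pose root v := iter N par v.
have itZ n z : z \in Z -> iter n par z = z.
  by move=> zZ; elim: n => //= n ->; apply: parZ.
have itd k v : v \in S -> d v <= k -> iter k par v \in Z.
  elim: k v => [|k IH] v vS; first by rewrite leqn0 => /eqP; apply: d0.
  move=> dk; rewrite iterSr; have [vZ|vZ] := boolP (v \in Z).
    by rewrite parZ // itZ.
  apply: IH; first exact: parS.
  have /andP[_ h] : r v (par v) && (d (par v) < d v) by apply: parP; rewrite inE vZ.
  by rewrite -ltnS; apply: leq_trans h dk.
have rootZ v : v \in S -> root v \in Z by move=> vS; apply: itd => //; case: (dP v vS).
have rootp v : v \in S -> root (par v) = root v.
  by move=> vS; rewrite /root -iterSr iterS parZ // rootZ.
have dwalk v : v \in S -> walk (parent_edge r par) (d v) v (root v).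
  have [k] := ubnP (d v); elim: k v => // k IH v dk vS.
  have [vZ|vZ] := boolP (v \in Z); first by rewrite /root itZ //; apply: walk0.
  have /andP[vp dp] : r v (par v) && (d (par v) < d v) by apply: parP; rewrite inE vZ.
  rewrite -rootp //; apply: (@walk_sub _ (parent_edge r par) _ (1 + d (par v))) => //.
  apply: walk_trans; last by apply: IH; rewrite ?parS //; apply: leq_trans dp _.
  by apply: walk1; rewrite /parent_edge /= vp eqxx.
exists par, root; split.
- by move=> z zZ; rewrite parZ // /root itZ.
- by move=> v /parP/andP[].
- by move=> v vS; rewrite rootZ // rootp.
split=> v vS; last by apply: walk_sub (dwalk v vS) => //; case: (dP v vS).
move=> n z zZ vz; apply: walk_sub (dwalk v vS) => //; apply: dmin => //.
by apply/exists_inP; exists z => //; apply/reachP.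
Qed.

Lemma count_blocks (T : eqType) (r : rel T) (a : pred T) l D (s : seq T) :
  (forall u, size u = l -> sorted r u -> uniq u -> {subset u <= s} -> has a u) ->
  size s = D * l -> sorted r s -> uniq s -> D <= count a s.
Proof.
elim: D s => // D IH s block ss rs us; rewrite mulSn in ss.
have st : size (take l s) = l by rewrite size_takel // ss leq_addr.
rewrite -(cat_take_drop l s) count_cat -add1n; apply: leq_add.
  rewrite -has_count; apply: block => //.
  - exact: take_sorted.
  - exact: take_uniq.
  - exact: mem_take.
apply: IH.
- move=> u su ru uu us'; apply: block => // x /us'; exact: mem_drop.
- by rewrite size_drop ss addKn.
- exact: drop_sorted.
- exact: drop_uniq.
Qed.

Lemma walk_fibre (T : finType) (q : rel T) (C : eqType) (root : T -> C) n x y :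
  (forall u w, q u w -> root u = root w) -> walk q n x y ->
  walk [rel u w | q u w && (root u == root x)] n x y.
Proof.
move=> qr [p [pp lp sp]]; exists p; split=> // {lp sp}.
elim: p x pp => //= z p IH x /andP[xz pz]; rewrite xz eqxx /=.
by apply: sub_path (IH z pz) => u w /= /andP[-> /eqP->] /=; rewrite (qr _ _ xz).
Qed.

(** What is retained of the breadth-first forest: trees of depth at most [N], one for each root in
    [Z], which partition [S]. *)
Definition clustering (T : finType) (e : rel T) (S Z : {set T})
    (par root : T -> T) (N : nat) : Prop :=
  let r := restr e S in
  [/\ Z \subset S,
      {in Z, forall z, par z = z /\ root z = z},
      {in S :\: Z, forall v, r v (par v)},
      {in S, forall v, root v \in Z /\ root (par v) = root v} &
      {in S, forall v, walk (parent_edge r par) N v (root v)}].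

Definition cluster_rel (T : finType) (e : rel T) (S : {set T}) (root : T -> T) : rel T :=
  [rel z w | (z != w) && [exists x in S, exists y in S,
     [&& root x == z, root y == w & e x y]]].

Lemma parent_edge_sym (T : finType) (r : rel T) par :
  symmetric r -> symmetric (parent_edge r par).
Proof. by move=> rs x y; rewrite /parent_edge /= rs orbC. Qed.

Lemma cluster_rel_sym (T : finType) (e : rel T) S (root : T -> T) :
  symmetric e -> symmetric (cluster_rel e S root).
Proof.
move=> es.
suff h x y : cluster_rel e S root x y -> cluster_rel e S root y x.
  by move=> x y; apply/idP/idP; apply: h.
case/andP=> xy /exists_inP[u uS /exists_inP[v vS /and3P[fu fv uv]]].
rewrite /cluster_rel /= eq_sym xy; apply/exists_inP; exists v => //.
by apply/exists_inP; exists u => //; rewrite fu fv es uv.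
Qed.

Lemma parent_edge_root (T : finType) (e : rel T) S Z par root N u w :
  clustering e S Z par root N -> parent_edge (restr e S) par u w -> root u = root w.
Proof.
case=> _ _ _ rP _ /andP[/and3P[uS wS _] /orP[/eqP->|/eqP->]].
  by have [_ ->] := rP u uS.
by have [_ ->] := rP w wS.
Qed.

Lemma cluster_walk (T : finType) (e : rel T) S Z par root N x y :
  symmetric e -> clustering e S Z par root N -> x \in S -> y \in S -> root x = root y ->
  walk [rel u w | parent_edge (restr e S) par u w && (root u == root x)] (N + N) x y.
Proof.
move=> es cl xS yS xy; have [_ _ _ _ W] := cl; apply: walk_fibre.
  by move=> u w; apply: parent_edge_root cl.
apply: walk_trans (W x xS) _; rewrite xy; apply: walk_sym (W y yS).
by apply: parent_edge_sym; apply: restr_sym.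
Qed.

(** An edge outside the forest would close a cycle of at most [2 * N + 1] vertices with the tree
    walk between its ends. *)
Lemma cluster_inner_edge (T : finType) (e : rel T) S Z par root N g x y :
  symmetric e -> irreflexive e -> girth_at_least e g ->
  clustering e S Z par root N -> (N + N).+1 < g ->
  x \in S -> y \in S -> e x y -> root x = root y -> parent_edge (restr e S) par x y.
Proof.
move=> es ei eg cl gN xS yS xy rxy; apply: contraTT gN => nq; rewrite -leqNgt.
have qs := parent_edge_sym par (restr_sym S es).
apply: (walk_around_edge es ei eg xy).
apply: walk_sub (cluster_walk es cl xS yS rxy) => // u w /andP[q _].
have /andP[/and3P[_ _ /= ->] _] := q; apply: contra nq.
by case/orP=> /andP[/eqP<- /eqP<-] //; rewrite qs.
Qed.

(** A second edge between the same clusters, with a tree walk in each of them, gives a walk of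
    length at most [4 * N + 1] around the first edge. *)
Lemma cluster_cross_edge (T : finType) (e : rel T) S Z par root N g x y x' y' :
  symmetric e -> irreflexive e -> girth_at_least e g ->
  clustering e S Z par root N -> (N + N + (1 + (N + N))).+1 < g ->
  x \in S -> y \in S -> x' \in S -> y' \in S -> e x y -> e x' y' ->
  root x = root x' -> root y = root y' -> root x != root y -> (x', y') = (x, y).
Proof.
move=> es ei eg cl gN xS yS xS' yS' xy xy' rx ry nr; apply/eqP.
apply: contraTT gN => ne; rewrite -leqNgt.
apply: (walk_around_edge es ei eg xy).
have sub c : subrel [rel u w | parent_edge (restr e S) par u w && (root u == c)]
    [rel u v | e u v && ~~ ((u == x) && (v == y) || (u == y) && (v == x))].
  move=> u w /andP[q _]; have ruw := parent_edge_root cl q.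
  have /andP[/and3P[_ _ /= ->] _] := q; apply: contra nr.
  by case/orP=> /andP[/eqP<- /eqP<-]; rewrite ruw.
apply: walk_trans (walk_sub (sub _) (leqnn _) (cluster_walk es cl xS xS' rx)) _.
apply: walk_trans (walk_sub (sub _) (leqnn _) (cluster_walk es cl yS' yS (esym ry))).
apply: walk1; rewrite /= xy' -!xpair_eqE negb_or ne /=; apply: contra nr.
by rewrite xpair_eqE => /andP[/eqP h _]; rewrite rx h.
Qed.

(** A cluster is a tree: its inner edges give at most two ordered pairs for each vertex other than
    the root, and its outer edges lead to pairwise different clusters. *)
Lemma cluster_degree (T : finType) (e : rel T) S Z par root N g z :
  symmetric e -> irreflexive e -> girth_at_least e g ->
  clustering e S Z par root N -> (N + N + (1 + (N + N))).+1 < g -> z \in Z ->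
  \sum_(x in [set x in S | root x == z]) deg_in e S x + 2 <=
  deg_in (cluster_rel e S root) Z z + 2 * #|[set x in S | root x == z]|.
Proof.
move=> es ei eg cl gN zZ; set A := [set x in S | root x == z].
have [ZS parZ parN rP _] := cl.
have zS : z \in S by apply: (subsetP ZS).
have zA : z \in A by rewrite inE zS; have [_ ->] := parZ z zZ; rewrite eqxx.
pose E := [set u : T * T | [&& u.1 \in A, u.2 \in S & e u.1 u.2]].
have -> : \sum_(x in A) deg_in e S x = #|E|.
  rewrite -sum1_card /deg_in; under eq_bigr do rewrite -sum1_card.
  by rewrite pair_big_dep; apply: eq_bigl => -[x y]; rewrite !inE.
rewrite -(cardsID [set u | u.2 \in A] E).
have inner : #|E :&: [set u | u.2 \in A]| + 2 <= 2 * #|A|.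
  rewrite (cardsD1 z A) zA mulnDr addnC leq_add2l.
  pose P := [set (x, par x) | x in A :\ z].
  pose P' := [set (par x, x) | x in A :\ z].
  apply: leq_trans (_ : #|P :|: P'| <= _); last first.
    apply: leq_trans (leq_card_setU _ _) _; rewrite mul2n -addnn.
    by apply: leq_add; apply: leq_imset_card.
  apply: subset_leq_card; apply/subsetP => -[x y]; rewrite !inE /=.
  case/andP=> /and3P[/andP[xS /eqP xz] yS xy] /andP[_ /eqP yz].
  have notz u w : u \in S -> root u = z -> e u w -> w = par u -> u \in A :\ z.
    move=> uS uz uw wu; rewrite !inE uS uz eqxx !andbT; apply/eqP => h.
    by have [pz _] := parZ z zZ; move: uw; rewrite wu h pz ei.
  have /andP[_ /orP[/eqP yx|/eqP xy']] :
    parent_edge (restr e S) par x y.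
  - apply: (cluster_inner_edge es ei eg cl) => //; last by rewrite yz.
    by apply: leq_ltn_trans gN; rewrite ltnS leq_addr.
  - by apply/orP; left; apply/imsetP; exists x; [apply: (notz x y)|rewrite -yx].
  - apply/orP; right; apply/imsetP; exists y; last by rewrite -xy'.
    by apply: (notz y x) => //; rewrite es.
suff outer : #|E :\: [set u | u.2 \in A]| <= deg_in (cluster_rel e S root) Z z.
  by move: inner outer; lia.
rewrite /deg_in -(card_in_imset (f := fun u => root u.2)).
  apply: subset_leq_card; apply/subsetP => _ /imsetP[[x y] + ->] /=.
  rewrite !inE /= => /and3P[+ /andP[xS /eqP xz] /andP[yS xy]]; rewrite yS /= => yz.
  have [-> _] := rP y yS; rewrite /cluster_rel /= eq_sym yz /=.
  apply/exists_inP; exists x => //; apply/exists_inP; exists y => //.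
  by rewrite xz !eqxx.
move=> [x y] [x' y']; rewrite !inE /=.
case/and3P=> + /andP[xS /eqP xz] /andP[yS xy]; rewrite yS /= => yz.
case/and3P=> _ /andP[xS' /eqP xz'] /andP[yS' xy'] ry.
apply/esym/(cluster_cross_edge es ei eg cl gN) => //; first by rewrite xz'.
by rewrite xz eq_sym.
Qed.

(* The clusters are the trees of a breadth-first forest rooted at a maximal set
   of vertices pairwise at distance more than [64 * l]; each of them contains a
   path with [32 * l] vertices, hence at least 32 vertices of degree 3 or more
   if no [l] consecutive ones have degree 2. *)
Lemma thread_or_clique_minor (T : finType) (e : rel T) (S : {set T}) g l :
  symmetric e -> irreflexive e -> girth_at_least e g -> S != set0 ->
  {in S, forall x, 2 <= deg_in e S x} -> 0 < l -> 256 * l + 2 < g ->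
  clique_minor e S 5 \/
  exists s, [/\ size s = l, uniq s, sorted e s &
             {in s, forall x, x \in S /\ deg_in e S x = 2}].
Proof.
move=> es ei eg S0 dS l0 gl; set r := restr e S.
pose a x := 2 < deg_in e S x.
have [/existsP[s /and3P[us ss /allP as_]]|nothread] := boolP [exists s : l.-tuple T,
    [&& uniq s, sorted r s & all (fun x => (x \in S) && ~~ a x) s]].
  right; exists s; split=> //; first exact: size_tuple.
    by apply: sub_sorted ss => x y /and3P[].
  move=> x /as_/andP[xS nx]; split=> //; have := dS x xS; move: nx.
  by rewrite /a; lia.
left; pose rad := 32 * l; pose N := rad + rad.
have rs : symmetric r by apply: restr_sym.
have [Z [ZS sep near]] := separated_net S N rs.
have rS x y : r x y -> y \in S by case/and3P.
have [par [root [parZ parN rP [Wmin W]]]] := parent_forest rs rS ZS near.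
have cl : clustering e S Z par root N by [].
have qr : subrel (parent_edge r par) r by move=> x y /andP[].
apply: (@clique_minor_quotient _ _ e (cluster_rel e S root) S Z root).
- move=> z zZ; apply/set0Pn; exists z; rewrite inE (subsetP ZS) //=.
  by have [_ ->] := parZ z zZ.
- move=> z zZ x y; rewrite !inE => /andP[xS /eqP xz] /andP[yS /eqP yz].
  have := cluster_walk es cl xS yS; rewrite xz yz => /(_ erefl)[p [pp <- _]].
  apply/connectP; exists p => //; apply: sub_path pp => u v /andP[uv /eqP uz].
  have /andP[/and3P[uS vS /= euv] _] := uv; rewrite /restr /= !inE uS vS uz eqxx euv.
  by rewrite -(parent_edge_root cl uv) uz eqxx.
- move=> z w zZ wZ /andP[_ /exists_inP[x xS /exists_inP[y yS]]].
  by case/and3P=> /eqP xz /eqP yw xy; exists x, y.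
apply: mader.
- exact: cluster_rel_sym.
- by move=> z; rewrite /cluster_rel /= eqxx.
- have /set0Pn[x xS] := S0; have [z zZ _] := near x xS.
  by apply/set0Pn; exists z.
rewrite mulnC -sum_nat_const; apply: leq_sum => z zZ.
(* Here [N = 64 * l], so [4 * N + 2] is [256 * l + 2]. *)
have gN : (N + N + (1 + (N + N))).+1 < g by rewrite /N /rad; move: gl; lia.
have zS : z \in S by apply: (subsetP ZS).
have radg : rad.-1 < g by rewrite /rad; move: gl; lia.
have [x [p [pp lp up pS sp]]] := long_path es ei eg dS zS radg.
have size_s : size (x :: p) = 32 * l by rewrite /= sp prednK // /rad muln_gt0.
have cnt : 32 <= count a (x :: p).
  apply: (@count_blocks _ r a l) => // u su ru uu us.
  have tu : size u == l by apply/eqP.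
  move/existsPn/(_ (Tuple tu)): nothread; rewrite /= uu ru /= -has_predC.
  case/hasP=> y yu /=; rewrite negb_and negbK => /orP[|ay]; first by rewrite pS // us.
  by apply/hasP; exists y.
set A := [set x in S | root x == z].
(* A vertex of the path is within [rad] of [z], hence also within [rad] of its own root; the two
   roots are then at distance at most [N], so they coincide. *)
have sA : {subset x :: p <= A}.
  move=> v vp; have vS := pS v vp; rewrite inE vS /= eq_sym; apply: contraT => nz.
  have [rZ _] := rP v vS; case: (sep z (root v) zZ rZ nz).
  have vz : walk r rad v z.
    move: pp lp vp sp; clear -l0; move=> pp lp vp sp.
    have spr : size p <= rad by rewrite sp leq_pred.
    move: pp lp spr {sp}; case/splitPl: p / vp => p1 p2 lv.
    rewrite cat_path lv => /andP[_ pp2] lp; rewrite size_cat => s12; exists p2.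
    split=> //; first by rewrite -lp last_cat lv.
    by apply: leq_trans s12; apply: leq_addl.
  apply: walk_trans (walk_sym rs vz) _.
  by apply: walk_sub (Wmin v vS _ _ zZ vz).
have := cluster_degree es ei eg cl gN zZ; rewrite -/A.
(* By [cluster_degree], an excess of 32 over [2 * #|A|] gives at least [32 = 2 ^ 5] neighbouring
   clusters, as [mader] requires. *)
suff : 2 * #|A| + 32 <= \sum_(x in A) deg_in e S x by move: #|A| (deg_in _ _ _) (\sum_(_ in _) _); lia.
apply: leq_trans (_ : \sum_(x in A) (2 + a x) <= _); last first.
  apply: leq_sum => v; rewrite inE => /andP[vS _]; have := dS v vS.
  by rewrite /a; case: ltnP => //; lia.
rewrite big_split /= sum_nat_const mulnC leq_add2l.
have -> : \sum_(v in A) (a v : nat) = #|[set v in A | a v]|.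
  by rewrite -sum1dep_card big_mkcondr; apply: eq_bigr.
rewrite (leq_trans cnt) // -size_filter.
have uf : uniq (filter a (x :: p)) by apply: filter_uniq.
rewrite -(card_uniqP uf); apply: subset_leq_card; apply/subsetP => v.
by rewrite mem_filter inE => /andP[-> /sA ->].
Qed.

(** * Colourings *)

(* A colour of phase i belongs to the sets at times congruent to i modulo 3, and
   may change phase only after a time at which it occurs: thus it occurs at
   least once in any three consecutive times. *)
Definition phase_class (C : finType) (a : {ffun C -> 'I_3}) (t : nat) : {set C} :=
  [set c | a c == t %% 3 :> nat].

Definition phases_ok (C : finType) (k : nat) (a : {ffun C -> 'I_3}) : Prop :=
  forall t, #|phase_class a t| <= k.

Definition phase_step (C : finType) (k t : nat) (a a' : {ffun C -> 'I_3}) : Prop :=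
  phases_ok k a' /\ forall c, c \notin phase_class a t -> a' c = a c.

Fixpoint evolve (C : finType) (k n t : nat) (a b : {ffun C -> 'I_3}) : Prop :=
  if n is m.+1 then exists a', phase_step k t a a' /\ evolve k m t.+1 a' b else a = b.

Lemma evolve_trans (C : finType) k m n t (a b c : {ffun C -> 'I_3}) :
  evolve k m t a b -> evolve k n (t + m) b c -> evolve k (m + n) t a c.
Proof.
elim: m t a => [|m IH] t a /=; first by rewrite addn0 => ->.
case=> a' [st ev] ev'; exists a'; split=> //; apply: IH ev _.
by rewrite addSnnS.
Qed.

Lemma evolve_idle (C : finType) k n t (a : {ffun C -> 'I_3}) :
  phases_ok k a -> evolve k n t a a.
Proof. by move=> ok; elim: n t => //= n IH t; exists a; split=> //. Qed.

(** The colour [c] occurs at one of three consecutive times, and may change phase right after it. *)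
Lemma evolve_one (C : finType) k t (a a' : {ffun C -> 'I_3}) c :
  phases_ok k a -> phases_ok k a' -> (forall d, d != c -> a' d = a d) ->
  evolve k 3 t a a'.
Proof.
move=> ok ok' aa'.
have [i [j [ij tc]]] : exists i j, i + j.+1 = 3 /\ (t + i) %% 3 = a c.
  have := ltn_ord (a c); have := ltn_pmod t (isT : 0 < 3).
  move: (nat_of_ord (a c)) => u w3 u3.
  by exists ((u + 3 - t %% 3) %% 3), (2 - (u + 3 - t %% 3) %% 3); lia.
rewrite -ij; apply: evolve_trans (evolve_idle _ _ ok) _.
exists a'; split; last exact: evolve_idle.
split=> // d; rewrite inE tc => dc; apply: aa'; apply: contraNneq dc => ->.
by rewrite eqxx.
Qed.

Definition set_phase (C : finType) (a : {ffun C -> 'I_3}) (c : C) (j : 'I_3) :=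
  [ffun d => if d == c then j else a d].

Lemma card_set_phase (C : finType) (a : {ffun C -> 'I_3}) c j t :
  #|phase_class (set_phase a c j) t| <= (j == t %% 3 :> nat) + #|phase_class a t|.
Proof.
case: eqP => jt; last first.
  apply: subset_leq_card; apply/subsetP => d; rewrite !inE ffunE.
  by case: (d == c) => [/eqP|].

apply: leq_trans (_ : #|c |: phase_class a t| <= _); last first.
  by rewrite cardsU1; case: (_ \notin _); rewrite ?leq_add2r.
apply: subset_leq_card; apply/subsetP => d; rewrite !inE ffunE.
by case: (d == c).
Qed.

Lemma set_phase_ok (C : finType) k (a : {ffun C -> 'I_3}) c (j : 'I_3) :
  phases_ok k a -> #|phase_class a j| < k -> phases_ok k (set_phase a c j).
Proof.
move=> ok jk t; apply: leq_trans (card_set_phase _ _ _ _) _.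
case: eqP => [jt|_]; last exact: ok.
rewrite add1n (leq_trans _ jk) // ltnS; apply: eq_leq; congr #|pred_of_set _|.
by apply/setP => d; rewrite !inE -jt modn_small.
Qed.

(** Three classes of at least [k] colours would use up [3 * k] colours; this is the free place of
    the puzzle. *)
Lemma phase_class_room (C : finType) k (a : {ffun C -> 'I_3}) :
  #|C| < 3 * k -> exists i : 'I_3, #|phase_class a i| < k.
Proof.
move=> hC; apply/existsP; apply: contraTT hC => /existsPn h.
rewrite -leqNgt -[#|C|]sum1_card (partition_big a predT) //=.
rewrite -{1}(card_ord 3) -sum_nat_const; apply: leq_sum => i _.
have := h i; rewrite -leqNgt => /leq_trans; apply.
rewrite -sum1_card; apply: eq_leq; apply: eq_bigl => c.
by rewrite !inE modn_small.
Qed.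

(* If the class where a colour should go is full, then it holds a colour which
   is misplaced, and which is first moved to a class with room. *)
Lemma evolve_rearrange (C : finType) k m t (a b : {ffun C -> 'I_3}) :
  #|C| < 3 * k -> phases_ok k a -> phases_ok k b ->
  #|[set c | a c != b c]| <= m -> evolve k (6 * m) t a b.
Proof.
move=> hC oka okb; elim: m a t oka => [|m IH] a t oka hm.
  rewrite muln0 /=; apply/ffunP => c; apply/eqP; apply: contraTT hm => ac.
  by rewrite -ltnNge; apply/card_gt0P; exists c; rewrite inE.
have [->|/eqP nab] := eqVneq a b; first exact: evolve_idle.
have [c ac] : exists c, a c != b c.
  by apply/existsP; apply: contra_notT nab => /existsPn h; apply/ffunP => c; apply/eqP/negbNE.
have less a' : (forall d, a' d != b d -> d != c /\ a d != b d) ->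
    #|[set c | a' c != b c]| <= m.
  move=> h; rewrite -ltnS; apply: leq_trans hm.
  rewrite [X in _ < X](cardsD1 c) inE ac add1n ltnS.
  apply: subset_leq_card; apply/subsetP => d.
  by rewrite !inE => /h[-> ->].
have [jk|] := ltnP #|phase_class a (b c)| k.
  (* Three times for the move, and three idle ones to match the six of the other case. *)
  rewrite mulnS -[6]/(3 + 3) -addnA.
  have ok' := set_phase_ok c oka jk.
  apply: evolve_trans (evolve_trans (evolve_idle 3 _ ok') (IH _ _ ok' _)).
    by apply: (@evolve_one _ _ _ _ _ c) => // d; rewrite ffunE => /negPf->.
  apply: less => d; rewrite ffunE; case: (eqVneq d c) => [->|//].
  by rewrite eqxx.
move=> full.
(* The class of phase [b c] is full in [a] without [c]; were all its colours well placed, [b] would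
   have more than [k] colours of that phase. *)
have [d da db] : exists2 d, a d = b c & b d != b c.
  have : ~~ (phase_class a (b c) \subset phase_class b (b c)).
    apply/negP => sub; have : phase_class a (b c) \proper phase_class b (b c).
      rewrite properE sub; apply/subsetPn; exists c; rewrite !inE modn_small //.
    by move/proper_card; rewrite ltnNge (leq_trans (okb _) full).
  case/subsetPn=> d; rewrite !inE modn_small // => /eqP da db.
  by exists d => //; apply: val_inj.
have cd : c != d by apply: contraNneq ac => e; rewrite {1}e da.
have [i ik] := phase_class_room a hC.
have ib : i != b c by apply: contraTneq ik => ->; rewrite -leqNgt.
have ok1 := set_phase_ok d oka ik.
have ok2 : phases_ok k (set_phase (set_phase a d i) c (b c)).
  apply: set_phase_ok => //; apply: leq_trans (oka (b c)).
  rewrite [in X in _ <= X](cardsD1 d) inE da modn_small // eqxx add1n ltnS.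
  apply: subset_leq_card; apply/subsetP => x; rewrite !inE ffunE modn_small //.
  case: (x == d) => /eqP/val_inj => [ibc|->]; first by rewrite ibc eqxx in ib.
  by rewrite eqxx.
rewrite mulnS -[6]/(3 + 3) -addnA.
(* The colour [d] makes room for [c]. It was misplaced before, so its detour does not increase the
   number of misplaced colours. *)
apply: evolve_trans (evolve_trans (b := set_phase (set_phase a d i) c (b c)) _ (IH _ _ ok2 _)).
- by apply: (@evolve_one _ _ _ _ _ d oka ok1) => x; rewrite ffunE => /negPf->.
- by apply: (@evolve_one _ _ _ _ _ c ok1 ok2) => x; rewrite [in LHS]ffunE => /negPf->.
- apply: less => x; rewrite !ffunE; case: (eqVneq x c) => [->|_]; first by rewrite eqxx.
  by case: (eqVneq x d) => [->|//] _; split=> //; rewrite da eq_sym db.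
Qed.

Lemma evolve_seq (C : finType) k n t (a b : {ffun C -> 'I_3}) :
  phases_ok k a -> phases_ok k b -> evolve k n t a b ->
  exists f : nat -> {ffun C -> 'I_3},
    [/\ f 0 = a, forall i, n <= i -> f i = b, forall i, phases_ok k (f i) &
        forall i, phase_step k (t + i) (f i) (f i.+1)].
Proof.
elim: n t a => [|n IH] t a oka okb /=.
  by move=> ->; exists (fun=> b).
case=> a' [st /(IH _ _ st.1 okb)[f [f0 fn fok fs]]].
exists (fun i => if i is j.+1 then f j else a); split=> //.
- by case=> // i; apply: fn.
- by case.
- case=> [|i]; first by rewrite addn0 f0.
  by rewrite -addSnnS; apply: fs.
Qed.

(** [X], [Y] and the remaining colours are the classes of a phase assignment, of size at most [k] as
    [#|C| < 3 * k]; likewise [X'] and [Y'] at time [n]. Evolving from one assignment to the other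
    keeps every colour present in any three consecutive sets. *)
Lemma interpolate_sets (C : finType) k n (X Y X' Y' : {set C}) :
  #|C| < 3 * k -> #|X| = k -> #|Y| = k -> #|X'| = k -> #|Y'| = k ->
  [disjoint X & Y] -> [disjoint X' & Y'] -> 18 * k <= n ->
  exists A : nat -> {set C},
    [/\ A 0 = X, A 1 = Y, A n = X' & A n.+1 = Y'] /\
    [/\ forall i, #|A i| <= k &
        forall i c, [|| c \in A i, c \in A i.+1 | c \in A i.+2]].
Proof.
move=> hC cX cY cX' cY' dXY dXY' nk.
pose ph (U V : {set C}) (s : nat) : {ffun C -> 'I_3} :=
  [ffun c => if c \in U then inord (s %% 3)
             else if c \in V then inord (s.+1 %% 3) else inord (s.+2 %% 3)].
have m3 x : x %% 3 < 3 by rewrite ltn_pmod.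
have neq s i j : (s + i) %% 3 == (s + j) %% 3 = (i %% 3 == j %% 3) by apply: eqn_modDl.
have phE (U V : {set C}) s : [disjoint U & V] ->
    [/\ phase_class (ph U V s) s = U, phase_class (ph U V s) s.+1 = V &
        phase_class (ph U V s) s.+2 = ~: (U :|: V)].
  move=> dUV; have nUV c : c \in V -> c \notin U.
    by move=> cV; apply: contraTN cV => cU; rewrite (disjointFr dUV).
  have e0 := neq s 0 1; have e1 := neq s 0 2; have e2 := neq s 1 2.
  rewrite !addnS !addn0 in e0 e1 e2.
  split; apply/setP => c; rewrite !inE ffunE; have := nUV c;
    case: (boolP (c \in U)) => cU; case: (boolP (c \in V)) => cV h;
    rewrite ?inordK // ?eqxx // ?e0 ?e1 ?e2 // ?(eq_sym (s.+1 %% 3)) ?(eq_sym (s.+2 %% 3)) ?e0 ?e1 ?e2 //;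
    by have := h isT.
have phok (U V : {set C}) s : #|U| = k -> #|V| = k -> [disjoint U & V] -> phases_ok k (ph U V s).
  move=> cU cV dUV t; have [c0 c1 c2] := phE U V s dUV.
  have : [|| t %% 3 == s %% 3, t %% 3 == s.+1 %% 3 | t %% 3 == s.+2 %% 3] by lia.
  have cong u : t %% 3 == u %% 3 -> phase_class (ph U V s) t = phase_class (ph U V s) u.
    by move=> /eqP tu; apply/setP => c; rewrite !inE tu.
  case/or3P=> /cong->; rewrite ?c0 ?c1 ?c2 ?cU ?cV //.
  have := cardsC (U :|: V); rewrite cardsU (disjoint_setI0 dUV) cards0 cU cV subn0.
  by move: hC #|~: _|; lia.
have ok1 := phok _ _ 0 cX cY dXY; have ok2 := phok _ _ n cX' cY' dXY'.
have ev : evolve k n.-1 1 (ph X Y 0) (ph X' Y' n).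
  pose m := #|[set c | ph X Y 0 c != ph X' Y' n c]|.
  have mC : m <= #|C| by apply: max_card.
  (* At most [3 * k - 1] colours are misplaced, so [6 * m] is at most [18 * k - 6]; the remaining
     times are idle. *)
  have -> : n.-1 = 6 * m + (n.-1 - 6 * m) by move: hC mC nk; lia.
  by apply: evolve_trans (evolve_idle _ _ ok2); apply: evolve_rearrange.
have [f [f0 fn fok fs]] := evolve_seq ok1 ok2 ev.
have [a0 a1 _] := phE X Y 0 dXY; have [b0 b1 _] := phE X' Y' n dXY'.
have n0 : 0 < n by move: hC nk; lia.
(* [f i] is in force at time [i + 1], and [f 0] also at time 0: the first change of phase follows
   time 1. *)
exists (fun i => if i is j.+1 then phase_class (f j) j.+1 else X); split.
  split=> //; rewrite ?f0 ?a1 //.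
    by rewrite -(prednK n0) fn // prednK // b0.
  by rewrite fn ?leq_pred // b1.
split; first by case=> [|i]; [rewrite cX|apply: fok].
have next i c : c \notin phase_class (f i) i.+1 -> f i.+1 c = f i c.
  by case: (fs i) => _; apply; rewrite add1n.
have trio t (a : {ffun C -> 'I_3}) c : [|| c \in phase_class a t, c \in phase_class a t.+1 | c \in phase_class a t.+2].
  by rewrite !inE; have := ltn_ord (a c); lia.
have shift i c t : f i.+1 c = f i c ->
    (c \in phase_class (f i.+1) t) = (c \in phase_class (f i) t).
  by move=> e; rewrite !inE e.
case=> [|i] c.
  have := trio 0 (f 0) c; rewrite {1}f0 a0.
  case: (c \in X) => //=; have := @next 0 c; case: (c \in _) => //= /(_ isT) h.
  by rewrite shift.
have := trio i.+1 (f i) c.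
have := @next i c; case: (c \in phase_class (f i) _) => //= /(_ isT) h1.
rewrite -!(shift i) //.
have := @next i.+1 c; case: (c \in phase_class (f i.+1) _) => //= /(_ isT) h2.
by rewrite (shift i.+1).
Qed.

(** * Extending partial colourings by leaves and threads *)

Lemma pad_set (C : finType) k (A D : {set C}) :
  A \subset D -> #|A| <= k <= #|D| ->
  exists B : {set C}, [/\ A \subset B, B \subset D & #|B| = k].
Proof.
move=> AD /andP[Ak kD]; move Em: (k - #|A|) => m.
elim: m A AD Ak Em => [|m IH] A AD Ak Em.
  by exists A; split=> //; apply/eqP; rewrite eqn_leq Ak -subn_eq0 Em.
have [x xD xA] : exists2 x, x \in D & x \notin A.
  have : A \proper D by rewrite properEcard AD; move: Ak kD Em; lia.
  by case/properP=> _ [x]; exists x.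
have cx : #|x |: A| = #|A|.+1 by rewrite cardsU1 xA.
have [||| B [AB BD cB]] := IH (x |: A).
- by rewrite subUset sub1set xD.
- by rewrite cx; move: Em; lia.
- by rewrite cx; move: Em; lia.
by exists B; split=> //; apply: subset_trans AB; apply: subsetUr.
Qed.

(* The last condition is what makes it possible to dominate a vertex of degree 1
   when it gets a second neighbour. *)
Definition partial_domatic (T C : finType) (e : rel T) (S : {set T}) (k : nat)
    (phi : T -> {set C}) : Prop :=
  [/\ {in S, forall v, #|phi v| = k},
      {in S, forall v, 2 <= deg_in e S v ->
         forall c, c \in phi v \/ exists u, [/\ u \in S, e v u & c \in phi u]} &
      {in S &, forall u v, e u v -> deg_in e S v = 1 -> [disjoint phi u & phi v]}].

Lemma deg_in_eq (T : finType) (e : rel T) (S S' : {set T}) x :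
  S' \subset S -> (forall y, y \in S -> e x y -> y \in S') ->
  deg_in e S x = deg_in e S' x.
Proof.
move=> sub h; apply: eq_card => y; rewrite !inE.
apply/andP/andP=> -[yS xy]; split=> //; first exact: h.
exact: (subsetP sub).
Qed.

Lemma partial_domatic_extend (T C : finType) (e : rel T) (S S' : {set T}) k
    (phi phi' : T -> {set C}) x :
  symmetric e -> S' \subset S -> {in S', phi =1 phi'} ->
  (forall y, y \in S -> e x y -> y \in S') -> x \in S' ->
  partial_domatic e S' k phi ->
  (2 <= deg_in e S x ->
     forall c, c \in phi' x \/ exists u, [/\ u \in S, e x u & c \in phi' u]) /\
  (forall u, u \in S -> e u x -> deg_in e S x = 1 -> [disjoint phi' u & phi' x]).
Proof.
move=> es sub pp N xS' [p1 p2 p3]; rewrite (deg_in_eq sub N); split.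
  move=> dx c; have [cx|[u [uS' xu cu]]] := p2 x xS' dx c; first by left; rewrite -pp.
  by right; exists u; rewrite -pp // (subsetP sub).
move=> u uS ux d1; have uS' : u \in S' by apply: N; rewrite // es.
by rewrite -!pp // p3.
Qed.

(** The colours of the new leaf [v] are taken outside [phi u], where [u] is its neighbour. If [u]
    was a leaf at [w], they must include all colours outside [phi u] and [phi w]; these are
    disjoint, so fewer than [k] colours are left over, and [2 * k <= #|C|] leaves enough to complete
    them. *)
Lemma add_leaf (T C : finType) (e : rel T) (S : {set T}) k (phi : T -> {set C}) v :
  symmetric e -> irreflexive e -> 2 * k <= #|C| < 3 * k -> v \in S ->
  deg_in e S v <= 1 -> partial_domatic e (S :\ v) k phi ->
  exists phi' : T -> {set C}, partial_domatic e S k phi'.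
Proof.
move=> es ei /andP[kC Ck] vS dv pd; have [p1 p2 p3] := pd.
have sub : S :\ v \subset S by apply: subsetDl.
have [D [cD Dd Dc]] : exists D : {set C}, [/\ #|D| = k,
    forall u, u \in S -> e v u -> [disjoint phi u & D] &
    forall u, u \in S -> e v u -> deg_in e (S :\ v) u = 1 ->
      forall c, c \in phi u \/ (exists w, [/\ w \in S :\ v, e u w & c \in phi w]) \/ c \in D].
  have [/exists_inP[u uS vu]|no] := boolP [exists u in S, e v u]; last first.
    have [] := @pad_set C k set0 setT; rewrite ?sub0set ?cards0 ?cardsT //=.
      by rewrite (leq_trans _ kC) // leq_pmull.
    move=> D [_ _ cD]; exists D; split=> // u uS vu; case/negP: no;
    by apply/exists_inP; exists u.
  have uniq_u w : w \in S -> e v w -> w = u.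
    move=> wS vw; apply/eqP; apply: contraTT dv => wu; rewrite -ltnNge.
    apply: leq_trans (_ : #|[set u; w]| <= _); first by rewrite cards2 eq_sym wu.
    apply: subset_leq_card; apply/subsetP => x.
    by rewrite !inE => /orP[]/eqP->; rewrite ?uS ?vu ?wS ?vw.
  have uv : u \in S :\ v by rewrite !inE uS andbT; apply: contraTneq vu => ->; rewrite ei.
  have cu := p1 u uv.
  have cCu : #|~: phi u| = #|C| - k by have := cardsC (phi u); rewrite cu; lia.
  have [R [Ru cR Rc]] : exists R : {set C}, [/\ R \subset ~: phi u, #|R| <= k &
      deg_in e (S :\ v) u = 1 -> forall c,
        c \in phi u \/ (exists w, [/\ w \in S :\ v, e u w & c \in phi w]) \/ c \in R].
    have [/cards1P[w Nw]|d1] := boolP (deg_in e (S :\ v) u == 1); last first.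
      by exists set0; rewrite sub0set cards0; split=> // /eqP d1'; rewrite d1' in d1.
    have : w \in [set w] by rewrite inE.
    rewrite -Nw inE => /andP[wS uw].
    have duw : [disjoint phi w & phi u] by apply: p3; rewrite // ?(es w) // /deg_in Nw cards1.
    exists (~: (phi w :|: phi u)); split.
    - by rewrite setCS subsetUr.
    - have := cardsC (phi w :|: phi u).
      rewrite cardsU (disjoint_setI0 duw) cards0 cu (p1 w wS) subn0.
      by move: Ck; lia.
    - move=> _ c; rewrite !inE negb_or; have [cu'|cu'] := boolP (c \in phi u); first by left.
      right; have [cw|cw] := boolP (c \in phi w); last by right.
      by left; exists w.
  have [|D [RD Du cD]] := @pad_set C k R (~: phi u) Ru.
    by rewrite cR cCu; move: kC; lia.
  exists D; split=> // w wS vw; rewrite (uniq_u w wS vw).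
    by rewrite disjoint_sym disjoints_subset.
  move=> d1 c; have [|[|cR']] := Rc d1 c; [by left|by right; left|].
  by right; right; apply: (subsetP RD).
pose phi' x := if x == v then D else phi x; exists phi'.
have pp : {in S :\ v, phi =1 phi'} by move=> x; rewrite !inE /phi' => /andP[/negPf->].
have main x : x \in S ->
    (2 <= deg_in e S x ->
       forall c, c \in phi' x \/ exists u, [/\ u \in S, e x u & c \in phi' u]) /\
    (forall u, u \in S -> e u x -> deg_in e S x = 1 -> [disjoint phi' u & phi' x]).
  move=> xS; have [->|xv] := eqVneq x v.
    split; first by move: dv; case: (deg_in _ _ _) => [|[]].
    move=> u uS uv _; rewrite -pp /phi' ?eqxx; first by apply: Dd; rewrite // es.
    by rewrite !inE uS andbT; apply: contraTneq uv => ->; rewrite ei.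
  have xS' : x \in S :\ v by rewrite !inE xv.
  have [vx|vx] := boolP (e v x); last first.
    apply: (partial_domatic_extend es sub pp _ xS' pd) => y yS xy; rewrite !inE yS andbT.
    by apply: contraNneq vx => <-; rewrite es.
  have dx : deg_in e S x = (deg_in e (S :\ v) x).+1.
    rewrite /deg_in (cardsD1 v) inE vS (es x) vx add1n; congr _.+1.
    by apply: eq_card => y; rewrite !inE andbA.
  rewrite dx; split.
    rewrite ltnS leq_eqVlt => /orP[/eqP d1|d2] c.
      have [cx|[[w [wS xw cw]]|cD']] := Dc x xS vx (esym d1) c.
      - by left; rewrite -pp.
      - by right; exists w; rewrite -pp // (subsetP sub).
      - by right; exists v; rewrite es /phi' eqxx.
    have [cx|[w [wS xw cw]]] := p2 x xS' d2 c; first by left; rewrite -pp.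
    by right; exists w; rewrite -pp // (subsetP sub).
  move=> u uS ux [d0]; have [->|uv] := eqVneq u v.
    by rewrite -(pp x) // /phi' eqxx disjoint_sym; apply: Dd.
  by move/eqP: d0; rewrite cards_eq0 => /eqP/setP/(_ u); rewrite !inE uv uS es ux.
split.
- move=> x xS; rewrite /phi'; case: eqP => // /eqP xv; apply: p1.
  by rewrite !inE xv.
- by move=> x /main[].
- by move=> u x uS /main[_ h] ux; apply: h.
Qed.

Lemma set2_deg_in (T : finType) (e : rel T) (S : {set T}) x u w y :
  deg_in e S x = 2 -> u \in S -> w \in S -> e x u -> e x w -> u != w ->
  y \in S -> e x y -> y = u \/ y = w.
Proof.
move=> d2 uS wS xu xw uw yS xy.
have /eqP N : [set u; w] == [set y in S | e x y].
  rewrite eqEcard cards2 uw; apply/andP; split; last by move: d2; rewrite /deg_in => ->.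
  by apply/subsetP => z; rewrite !inE => /orP[]/eqP->; rewrite ?uS ?wS.
have : y \in [set u; w] by rewrite N inE yS.
by rewrite !inE => /orP[]/eqP; [left|right].
Qed.

Lemma other_neighbour (T : finType) (e : rel T) (S : {set T}) x u :
  deg_in e S x = 2 -> exists w, [/\ w \in S, e x w & w != u].
Proof.
move=> d2; have : 0 < #|[set y in S | e x y] :\ u|.
  have := cardsD1 u [set y in S | e x y]; rewrite -/(deg_in e S x) d2.
  by case: (_ \in _); lia.
by case/card_gt0P=> w; rewrite !inE => /and3P[? ? ?]; exists w.
Qed.

(** The ends of [s] are kept and become leaves when the inner vertices [M] are removed. The leaf
    condition makes the sets of [y] and [x 0], and those of [x l.+2] and [w], disjoint, as the
    interpolation requires. *)
Lemma add_thread (T C : finType) (e : rel T) (S : {set T}) k (s : seq T) :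
  symmetric e -> irreflexive e -> 0 < k -> k <= #|C| < 3 * k ->
  18 * k <= size s -> uniq s -> sorted e s ->
  {in s, forall x, x \in S /\ deg_in e S x = 2} ->
  (forall S' : {set T}, S' \proper S -> exists phi : T -> {set C}, partial_domatic e S' k phi) ->
  exists phi : T -> {set C}, partial_domatic e S k phi.
Proof.
move=> es ei k0 /andP[kC Ck] ks us ss sS IH.
have [x0 [l [Es ls]]] : exists x0 l, size s = l.+3 /\ x0 \in s.
  case: s ks {us ss sS} => [|x0 s]; first by rewrite leqn0 muln_eq0; lia.
  by move=> /= ks; exists x0, (size s - 2); rewrite mem_head; split=> //; lia.
pose x i := nth x0 s i.
have xs i : i < l.+3 -> x i \in s by move=> il; apply: mem_nth; rewrite Es.
have xS i : i < l.+3 -> x i \in S by move=> /xs/sS[].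
have xd i : i < l.+3 -> deg_in e S (x i) = 2 by move=> /xs/sS[].
have xe i : i.+1 < l.+3 -> e (x i) (x i.+1).
  by move=> il; move/(sortedP x0): ss; apply; rewrite Es.
have xinj i j : i < l.+3 -> j < l.+3 -> x i = x j -> i = j.
  by move=> il jl /eqP; rewrite nth_uniq ?Es // => /eqP.
have [y [yS xy yx1]] := other_neighbour (x 1) (xd 0 isT).
have [w [wS xw wxl]] := other_neighbour (x l.+1) (xd l.+2 (ltnSn _)).
(* The thread prolonged by its outer neighbours: [X 0] is [y], [X i.+1] is [x i], and [X l.+4] is
   [w]. *)
pose X i := if i is j.+1 then if j < l.+3 then x j else w else y.
have XS i : X i \in S by case: i => [|i] //=; case: ifP => // /xS.
have Xe i : i <= l.+3 -> e (X i) (X i.+1).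
  case: i => [|i] /=; first by rewrite es.
  move=> il; rewrite il; case: ifP => il'; first exact: xe.
  by have -> : i = l.+2 by lia.
have Xn i : i < l.+3 -> X i != X i.+2.
  case: i => [|i] /= il; first by rewrite yx1.
  rewrite (ltnW il); case: ifP => il'.
    by apply/eqP => /xinj h; have := h (ltnW il) il'; lia.
  have -> : i = l.+1 by lia.
  by rewrite eq_sym.
have XN i u : i < l.+3 -> u \in S -> e (X i.+1) u -> u = X i \/ u = X i.+2.
  move=> il uS Xu; apply: (set2_deg_in (e := e) (S := S) (x := X i.+1)) => //.
  - by rewrite /= il xd.
  - by rewrite es; apply: Xe; apply: ltnW.
  - exact: Xe.
  - exact: Xn.
have sX v : v \in s -> exists2 i, i < l.+3 & v = X i.+1.
  by move/(nthP x0)=> [i]; rewrite Es => il <-; exists i => //=; rewrite il.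
pose M := [set v in s | (v != x 0) && (v != x l.+2)].
have xM i : 0 < i < l.+2 -> x i \in M.
  move=> /andP[i0 il]; have il' : i < l.+3 by apply: ltnW.
  rewrite inE xs //=; apply/andP; split; apply/eqP.
    by move/(xinj i 0 il' isT) => h; rewrite h in i0.
  by move/(xinj i l.+2 il' (ltnSn _)) => h; rewrite h ltnn in il.
have MX v : v \in M -> exists i, [/\ 0 < i, i < l.+2 & v = X i.+1].
  rewrite inE => /and3P[/sX[i il vE]]; rewrite {1 2}vE /= il => n0 nl; exists i; split=> //.
    by rewrite lt0n; apply: contraNneq n0 => ->.
  by rewrite ltn_neqAle -ltnS il andbT; apply: contraNneq nl => ->.
have MN v u : v \in M -> u \in S -> e v u -> exists i,
    [/\ 0 < i, i < l.+2, v = x i & u = x i.-1 \/ u = x i.+1].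
  move=> /MX[i [i0 il ->]] uS vu; have il' : i < l.+3 := leqW il.
  exists i; rewrite /= il'; split=> //.
  have := XN i u il' uS vu; case: i i0 il il' {vu} => // i _ il il' /=.
  by rewrite -[i.+2 < _]/(i.+1 < l.+2) il (ltnW il').
(* An inner vertex adjacent to [x 0] can only be [x 1]. The vertex [y] may still be the other end
   [x l.+2], when the thread closes up. *)
have yM : y \notin M.
  apply/negP => yM; have yx0 : e y (x 0) by rewrite es.
  have [i [+ + +]] := MN _ _ yM (xS 0 isT) yx0.
  case: i => // i _ il yi.
  case=> /= [/(xinj 0 i isT (ltnW (ltnW il))) i0|/(xinj 0 i.+2 isT il)//].
  by rewrite yi -i0 eqxx in yx1.
have wM : w \notin M.
  apply/negP => wM; have wxl' : e w (x l.+2) by rewrite es.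
  have [i [+ + +]] := MN _ _ wM (xS _ (ltnSn _)) wxl'.
  case: i => // i _ il wi.
  case=> /= [/(xinj l.+2 i (ltnSn _) (ltnW (ltnW il))) li|].
    by move: il; rewrite -li; lia.
  by move/(xinj l.+2 i.+2 (ltnSn _) il) => -[li]; rewrite wi -li eqxx in wxl.
pose S' := S :\: M.
have x0S' : x 0 \in S' by rewrite !inE eqxx andbF xS.
have xlS' : x l.+2 \in S' by rewrite !inE eqxx !andbF xS.
have yS' : y \in S' by rewrite inE yM.
have wS' : w \in S' by rewrite inE wM.
have sub : S' \subset S by apply: subsetDl.
have [phi pd] : exists phi : T -> {set C}, partial_domatic e S' k phi.
  apply: IH; rewrite properE sub; apply/subsetPn; exists (x 1); first exact: xS.
  by rewrite inE xM.
have [p1 p2 p3] := pd.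
have out v : v \in S -> v \notin s -> forall u, u \in S -> e v u -> u \in S'.
  move=> vS vs u uS vu; rewrite inE uS andbT; apply: contra vs => uM.
  have [i [i0 il _ [|] ->]] : exists i,
      [/\ 0 < i, i < l.+2, u = x i & v = x i.-1 \/ v = x i.+1].
    by apply: MN; rewrite // es.
  - exact/xs/(leq_ltn_trans (leq_pred i))/leqW.
  - exact: xs.
have d0 : deg_in e S' (x 0) = 1.
  apply/eqP/cards1P; exists y; apply/setP => u; rewrite in_set1 in_set in_setD.
  apply/idP/eqP => [/andP[/andP[uM uS] xu]|->]; last by rewrite yM yS.
  have [//|/= u1] := XN 0 u isT uS xu; by rewrite u1 xM in uM.
have dl : deg_in e S' (x l.+2) = 1.
  apply/eqP/cards1P; exists w; apply/setP => u; rewrite in_set1 in_set in_setD.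
  apply/idP/eqP => [/andP[/andP[uM uS] xu]|->]; last by rewrite wM wS.
  have := XN l.+2 u (ltnSn _) uS; rewrite /= !ltnSn ltnn leqnSn => /(_ xu)[u1|//].
  by rewrite u1 xM ?ltnSn in uM.
have disj0 : [disjoint phi y & phi (x 0)] by apply: p3; rewrite // es.
have displ : [disjoint phi (x l.+2) & phi w].
  by rewrite disjoint_sym; apply: p3; rewrite // es.
rewrite Es in ks.
have [A [[A0 A1 Al Al1] [Ak Ac]]] :=
  interpolate_sets Ck (p1 y yS') (p1 _ x0S') (p1 _ xlS') (p1 w wS') disj0 displ ks.
(* The interpolating sets have at most [k] colours; enlarging them to exactly [k] preserves
   domination. *)
pose pad i := odflt set0 [pick B : {set C} | (A i \subset B) && (#|B| == k)].
have padP i : A i \subset pad i /\ #|pad i| = k.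
  rewrite /pad; case: pickP => /= [B /andP[? /eqP]//|no].
  have [||B [AB _ cB]] := @pad_set C k (A i) setT; rewrite ?subsetT // ?Ak ?cardsT //.
  by have := no B; rewrite AB cB eqxx.
(* The vertex [x i] stands at time [i + 1], as time 0 belongs to [y]. *)
pose phi' v := if v \in M then pad (index v s).+1 else phi v; exists phi'.
have pp : {in S', phi =1 phi'} by move=> v; rewrite inE /phi' => /andP[/negPf->].
have AX i : i <= l.+4 -> A i \subset phi' (X i).
  case: i => [|i] il; first by rewrite A0 -pp.
  have [->|i0] := posnP i; first by rewrite A1 -pp.
  rewrite /=; have [il'|il'] := ltnP i l.+3; last first.
    have -> : i = l.+3 by apply/eqP; rewrite eqn_leq il' -ltnS il.
    by rewrite Al1 -pp.
  have [->|nl] := eqVneq i l.+2; first by rewrite Al -pp.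
  have xiM : x i \in M by apply: xM; rewrite i0 ltn_neqAle nl -ltnS il'.
  rewrite /phi' xiM index_uniq ?Es //; exact: (padP _).1.
split.
- move=> v vS; rewrite /phi'; case: (boolP (v \in M)) => [_|vM]; first exact: (padP _).2.
  by apply: p1; rewrite inE vM.
- move=> v vS dv c; have [vs|vs] := boolP (v \in s).
    (* The closed neighbourhood of a thread vertex carries three consecutive sets of [A]. *)
    have [i il ->] := sX v vs; case/or3P: (Ac i c) => cA.
    + right; exists (X i); rewrite es Xe ?(ltnW il) //; split=> //.
      by apply: (subsetP (AX i _)) => //; apply/leqW/ltnW.
    + by left; apply: (subsetP (AX i.+1 _)) => //; apply/leqW.
    + right; exists (X i.+2); rewrite Xe //; split=> //.
      by apply: (subsetP (AX i.+2 _)).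
  have vS' : v \in S' by rewrite !inE (negPf vs) vS.
  have [h _] := partial_domatic_extend es sub pp (out v vS vs) vS' pd.
  exact: h.
- move=> u v uS vS uv dv; have vs : v \notin s by apply/negP => /sS[_]; rewrite dv.
  have vS' : v \in S' by rewrite !inE (negPf vs) vS.
  have [_ h] := partial_domatic_extend es sub pp (out v vS vs) vS' pd.
  exact: h.
Qed.

Lemma partial_domatic_exists (T C : finType) (e : rel T) k (S : {set T}) :
  symmetric e -> irreflexive e -> 0 < k -> 2 * k <= #|C| < 3 * k ->
  (forall S' : {set T}, S' \subset S -> S' != set0 -> {in S', forall x, 2 <= deg_in e S' x} ->
     exists s, [/\ size s = 18 * k, uniq s, sorted e s &
             {in s, forall x, x \in S' /\ deg_in e S' x = 2}]) ->
  exists phi : T -> {set C}, partial_domatic e S k phi.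
Proof.
move=> es ei k0 kC thr; have [n] := ubnP #|S|; elim: n S thr => // n IH S thr Sn.
have IH' (S' : {set T}) : S' \proper S -> exists phi : T -> {set C}, partial_domatic e S' k phi.
  move=> SS'; apply: IH => [S'' sub|].
    by apply: thr; apply: subset_trans sub (proper_sub SS').
  by rewrite -ltnS (leq_trans _ Sn) // ltnS; apply: proper_card.
have [->|S0] := eqVneq S set0.
  by exists (fun=> set0); split=> ?; rewrite inE.
have [/exists_inP[v vS dv]|/exists_inPn big] := boolP [exists v in S, deg_in e S v <= 1].
  have [phi pd] := IH' _ (properD1 vS).
  exact: (add_leaf es ei kC vS dv pd).
have [|s [ss us se sS]] := thr S (subxx _) S0; first by move=> x /big; rewrite -ltnNge.
apply: (@add_thread _ _ _ _ _ s) => //; last by rewrite ss.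
by case/andP: kC => h ->; rewrite andbT (leq_trans _ h) // leq_pmull.
Qed.

From mathcomp Require Import all_order all_algebra.
From mathcomp Require Import ring lra.
Import Order.TTheory GRing.Theory Num.Theory.

Local Open Scope ring_scope.

(** * Crossings of polygonal drawings of K_5 *)

Definition det3 (R : realFieldType) (a b c : R * R) : R :=
  (b.1 - a.1) * (c.2 - a.2) - (b.2 - a.2) * (c.1 - a.1).

Definition ccw (R : realFieldType) (a b c : R * R) : bool := 0 < det3 a b c.

(** For points in general position: the segments [ab] and [cd] meet, the line through each
    separating the ends of the other. *)
Definition crosses (R : realFieldType) (a b c d : R * R) : bool :=
  (ccw a b c != ccw a b d) && (ccw c d a != ccw c d b).

Definition in_triangle (R : realFieldType) (p a b c : R * R) : bool :=
  (ccw a b p == ccw b c p) && (ccw b c p == ccw c a p).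

Lemma ccw_cycle (R : realFieldType) (a b c : R * R) : ccw b c a = ccw a b c.
Proof. by rewrite /ccw /det3; congr (_ < _); ring. Qed.

Lemma ccw_swap (R : realFieldType) (a b c : R * R) :
  det3 a b c != 0 -> ccw b a c = ~~ ccw a b c.
Proof.
have -> : ccw b a c = (det3 a b c < 0).
  by rewrite /ccw -oppr_lt0; congr (_ < _); rewrite /det3; ring.
by rewrite /ccw lt_neqAle -leNgt => ->.
Qed.

(** The terms [x], [- y], [z], [- t] have sum zero, so they cannot all have the same sign. The next
    lemma applies the same remark to three products. *)
Lemma signs_sum4 (R : realFieldType) (x y z t : R) :
  x != 0 -> y != 0 -> z != 0 -> t != 0 -> x - y + z - t = 0 ->
  ~~ [&& (0 < x) == (0 < z), (0 < y) == (0 < t) & (0 < x) != (0 < y)].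
Proof.
move=> x0 y0 z0 t0 e.
by case: (ltgtP x 0) x0 => // hx _; case: (ltgtP y 0) y0 => // hy _;
   case: (ltgtP z 0) z0 => // hz _; case: (ltgtP t 0) t0 => // ht _;
   first [done|exfalso; lra].
Qed.

Lemma signs_plucker (R : realFieldType) (x y z t u v : R) :
  x != 0 -> y != 0 -> z != 0 -> t != 0 -> u != 0 -> v != 0 ->
  x * y - z * t + u * v = 0 ->
  ~~ ((((0 < x) == (0 < y)) == ((0 < u) == (0 < v)))
      && (((0 < x) == (0 < y)) != ((0 < z) == (0 < t)))).
Proof.
have sg (a b : R) : a != 0 -> b != 0 -> (0 < a) == (0 < b) = (0 < a * b).
  move=> a0 b0; case: (ltgtP a 0) a0 => // ha _; case: (ltgtP b 0) b0 => // hb _.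
  - by rewrite nmulr_rgt0 // hb.
  - by rewrite nmulr_rgt0 // ltNge ltW.
  - by rewrite pmulr_rgt0 // ltNge ltW.
  - by rewrite pmulr_rgt0 // hb.
move=> x0 y0 z0 t0 u0 v0 e; rewrite (sg x y) // (sg u v) // (sg z t) //.
have xy := mulf_neq0 x0 y0; have zt := mulf_neq0 z0 t0; have uv := mulf_neq0 u0 v0.
move: (x * y) (z * t) (u * v) xy zt uv e => a b c a0 b0 c0 e.
by case: (ltgtP a 0) a0 => // ha _; case: (ltgtP b 0) b0 => // hb _;
   case: (ltgtP c 0) c0 => // hc _; first [done|exfalso; lra].
Qed.

(** Reflection: a boolean statement in ten variables is decided by evaluating it on all
    assignments. *)
Fixpoint bool_fun (n : nat) : Type := if n is m.+1 then bool -> bool_fun m else bool.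

Fixpoint bool_taut (n : nat) : bool_fun n -> bool :=
  if n is m.+1 then fun f => bool_taut (f true) && bool_taut (f false) else id.

Fixpoint bool_closure (n : nat) : bool_fun n -> Prop :=
  if n is m.+1 then fun f => forall b, bool_closure (f b) else is_true.

Lemma bool_tautP n (f : bool_fun n) : bool_taut f -> bool_closure f.
Proof.
elim: n f => //= n IH f /andP[ft ff] []; exact: IH.
Qed.

Definition acyclic4 (bcd acd abd abc : bool) : bool :=
  ~~ [&& bcd == abd, acd == abc & bcd != acd].

Definition plucker (abc ade abd ace abe acd : bool) : bool :=
  ~~ (((abc == ade) == (abe == acd)) && ((abc == ade) != (abd == ace))).

(* The sign conditions that come from the affine relation between any four of the
   five points, and from the three-term Grassmann-Plucker relations. *)
Definition chirotope5 (abc abd abe acd ace ade bcd bce bde cde : bool) : bool :=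
  [&& acyclic4 bcd acd abd abc, acyclic4 bce ace abe abc, acyclic4 bde ade abe abd,
      acyclic4 cde ade ace acd, acyclic4 cde bde bce bcd,
      plucker abc ade abd ace abe acd,
      plucker abc bde abd bce abe bcd,
      plucker abc cde acd bce ace bcd,
      plucker abd cde acd bde ade bcd &
      plucker abe cde ace bde ade bce].

Definition generic (R : realFieldType) (Q : pred (R * R)) : Prop :=
  {in Q & &, forall a b c, a != b -> a != c -> b != c -> det3 a b c != 0}.

Lemma chirotope5P (R : realFieldType) (Q : pred (R * R)) (a b c d e : R * R) :
  generic Q -> all Q [:: a; b; c; d; e] -> uniq [:: a; b; c; d; e] ->
  chirotope5 (ccw a b c) (ccw a b d) (ccw a b e) (ccw a c d) (ccw a c e)
    (ccw a d e) (ccw b c d) (ccw b c e) (ccw b d e) (ccw c d e).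
Proof.
move=> gQ /and5P[Qa Qb Qc Qd /andP[Qe _]].
rewrite /= !inE !negb_or -!andbA => /and4P[ab ac ad /and5P[ae bc bd be /and4P[cd ce de _]]].
have n := gQ; rewrite /generic in n.
have abc := n _ _ _ Qa Qb Qc ab ac bc; have abd := n _ _ _ Qa Qb Qd ab ad bd.
have abe := n _ _ _ Qa Qb Qe ab ae be; have acd := n _ _ _ Qa Qc Qd ac ad cd.
have ace := n _ _ _ Qa Qc Qe ac ae ce; have ade := n _ _ _ Qa Qd Qe ad ae de.
have bcd := n _ _ _ Qb Qc Qd bc bd cd; have bce := n _ _ _ Qb Qc Qe bc be ce.
have bde := n _ _ _ Qb Qd Qe bd be de; have cde := n _ _ _ Qc Qd Qe cd ce de.
apply/and5P; split; [| | | |apply/and5P; split; [| | | |apply/andP; split]];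
  solve [apply: signs_sum4 => //; rewrite /det3; ring
        |apply: signs_plucker => //; rewrite /det3; ring].
Qed.

(** The Jordan curve theorem for a triangle, modulo 2: a segment crosses the boundary an odd number
    of times when exactly one of its ends is inside. The identity is checked on the sign patterns
    that [chirotope5] admits. *)
Lemma triangle_parity (R : realFieldType) (Q : pred (R * R)) (a b c p q : R * R) :
  generic Q -> all Q [:: a; b; c; p; q] -> uniq [:: a; b; c; p; q] ->
  crosses a b p q (+) crosses b c p q (+) crosses c a p q =
  in_triangle p a b c (+) in_triangle q a b c.
Proof.
move=> gQ aQ u; have := chirotope5P gQ aQ u.
have [acp acq] : ccw c a p = ~~ ccw a c p /\ ccw c a q = ~~ ccw a c q.
  move: aQ u => /and5P[Qa _ Qc Qp /andP[Qq _]].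
  rewrite /= !inE !negb_or -!andbA => /and4P[ab ac ap /and5P[aq bc bp bq /and4P[cp cq pq _]]].
  by split; apply: ccw_swap; apply: gQ.
rewrite /crosses /in_triangle acp acq -(ccw_cycle p q a) -(ccw_cycle q a p).
rewrite -(ccw_cycle p q b) -(ccw_cycle q b p) -(ccw_cycle p q c) -(ccw_cycle q c p).
move: (ccw a b c) (ccw a b p) (ccw a b q) (ccw a c p) (ccw a c q) (ccw a p q)
  (ccw b c p) (ccw b c q) (ccw b p q) (ccw c p q).
by do 10 case.
Qed.

Definition K5_edges : seq (nat * nat) :=
  [:: (0, 1); (0, 2); (0, 3); (0, 4); (1, 2); (1, 3); (1, 4); (2, 3); (2, 4); (3, 4)]%N.

Definition independent (e f : nat * nat) : bool := uniq [:: e.1; e.2; f.1; f.2].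

Definition edge_lt (e f : nat * nat) : bool := (e.1 * 5 + e.2 < f.1 * 5 + f.2)%N.

(** Crossings correspond to convex quadrilaterals among five points, of which there are 5, 3 or 1
    according as the convex hull has 5, 4 or 3 vertices. Here the parity is checked on all
    admissible sign patterns. *)
Lemma K5_chirotope (o : nat -> nat -> nat -> bool) :
  (forall i j k, (i < j)%N -> (j < k)%N -> (k < 5)%N ->
     o j k i = o i j k /\ o i k j = ~~ o i j k) ->
  chirotope5 (o 0 1 2) (o 0 1 3) (o 0 1 4) (o 0 2 3) (o 0 2 4)
    (o 0 3 4) (o 1 2 3) (o 1 2 4) (o 1 3 4) (o 2 3 4) ->
  \big[addb/false]_(e <- K5_edges) \big[addb/false]_(f <- K5_edges |
      independent e f && edge_lt e f)
    ((o e.1 e.2 f.1 != o e.1 e.2 f.2) && (o f.1 f.2 e.1 != o f.1 f.2 e.2)).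
Proof.
move=> h; rewrite unlock /=.
have [abc1 abc2] := h 0 1 2 isT isT isT.
have [abd1 abd2] := h 0 1 3 isT isT isT.
have [abe1 abe2] := h 0 1 4 isT isT isT.
have [acd1 acd2] := h 0 2 3 isT isT isT.
have [ace1 ace2] := h 0 2 4 isT isT isT.
have [ade1 ade2] := h 0 3 4 isT isT isT.
have [bcd1 bcd2] := h 1 2 3 isT isT isT.
have [bce1 bce2] := h 1 2 4 isT isT isT.
have [bde1 bde2] := h 1 3 4 isT isT isT.
have [cde1 cde2] := h 2 3 4 isT isT isT.
rewrite ?abc1 ?abc2
  ?abd1 ?abd2
  ?abe1 ?abe2
  ?acd1 ?acd2
  ?ace1 ?ace2
  ?ade1 ?ade2
  ?bcd1 ?bcd2
  ?bce1 ?bce2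
  ?bde1 ?bde2
  ?cde1 ?cde2.
move: (o 0 1 2) (o 0 1 3) (o 0 1 4) (o 0 2 3) (o 0 2 4)
  (o 0 3 4) (o 1 2 3) (o 1 2 4) (o 1 3 4) (o 2 3 4).
move=> b0 b1 b2 b3 b4 b5 b6 b7 b8 b9; apply/implyP.
move: b0 b1 b2 b3 b4 b5 b6 b7 b8 b9.
refine (@bool_tautP 10 (fun b0 b1 b2 b3 b4 b5 b6 b7 b8 b9 => _) _).
by vm_compute.
Qed.

Lemma K5_straight_parity (R : realFieldType) (Q : pred (R * R)) (v : nat -> R * R) :
  generic Q -> (forall i, (i < 5)%N -> Q (v i)) ->
  (forall i j, (i < j < 5)%N -> v i != v j) ->
  \big[addb/false]_(e <- K5_edges) \big[addb/false]_(f <- K5_edges |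
      independent e f && edge_lt e f) crosses (v e.1) (v e.2) (v f.1) (v f.2).
Proof.
move=> gQ vQ vn; apply: (@K5_chirotope (fun i j k => ccw (v i) (v j) (v k))).
  move=> i j k ij jk k5; rewrite ccw_cycle; split=> //.
  rewrite (ccw_cycle (v j)) ccw_swap //; have i5 := ltn_trans ij (ltn_trans jk k5).
  have j5 := ltn_trans jk k5; apply: gQ; rewrite ?unfold_in ?vQ ?vn ?ij ?jk //.
  by rewrite (ltn_trans ij jk).
by apply: (chirotope5P gQ); rewrite /= ?vQ // !inE !negb_or !vn.
Qed.

(** * Crossing parity of polygonal chains *)

Definition steps (T : Type) (x : T) (l : seq T) : seq (T * T) := pairmap pair x l.

Definition crossing_parity (R : realFieldType) (s t : seq ((R * R) * (R * R))) : bool :=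
  \big[addb/false]_(u <- s) \big[addb/false]_(w <- t) crosses u.1 u.2 w.1 w.2.

(** Zero boundary modulo 2, in dual form: the coboundary of every function [h] sums to zero. This
    applies directly to [h] the indicator of a triangle. *)
Definition mod2_cycle (T : Type) (W : seq (T * T)) : Prop :=
  forall h : T -> bool, \big[addb/false]_(w <- W) (h w.1 (+) h w.2) = false.

Lemma crossesC (R : realFieldType) (a b c d : R * R) : crosses a b c d = crosses c d a b.
Proof. exact: andbC. Qed.

Lemma crossing_parityC (R : realFieldType) (s t : seq ((R * R) * (R * R))) :
  crossing_parity s t = crossing_parity t s.
Proof.
rewrite /crossing_parity exchange_big /=; apply: eq_bigr => w _.
by apply: eq_bigr => u _; rewrite crossesC.
Qed.

Lemma steps_mem (T : eqType) (x : T) l w : w \in steps x l ->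
  w.1 \in x :: l /\ w.2 \in x :: l.
Proof.
elim: l x => //= y l IH x; rewrite inE => /orP[/eqP->|/IH[h1 h2]].
  by rewrite /= !inE !eqxx orbT.
by split; rewrite in_cons; apply/orP; right.
Qed.

Lemma steps_neq (T : eqType) (x : T) l w :
  uniq (x :: l) -> w \in steps x l -> w.1 != w.2.
Proof.
elim: l x => //= y l IH x /andP[+ u]; rewrite inE => /norP[xy xl].
by rewrite inE => /orP[/eqP->//|/IH]; apply.
Qed.

Lemma steps_boundary (T : Type) (x y : T) l (h : T -> bool) :
  \big[addb/false]_(w <- steps x (rcons l y)) (h w.1 (+) h w.2) = h x (+) h y.
Proof.
elim: l x => [|z l IH] x; rewrite /= big_cons /=; first by rewrite big_nil addbF.
by rewrite IH addbA -(addbA (h x)) addbb addbF.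
Qed.

Lemma crosses_swap (R : realFieldType) (Q : pred (R * R)) (a b c d : R * R) :
  generic Q -> all Q [:: a; b; c; d] -> uniq [:: a; b; c; d] ->
  crosses b a c d = crosses a b c d.
Proof.
move=> gQ /and5P[Qa Qb Qc Qd _].
rewrite /= !inE !negb_or -!andbA => /and4P[ab ac ad /and3P[bc bd _]].
rewrite /crosses !(@ccw_swap _ a b) ?gQ // (eq_sym (ccw c d b)).
by case: (ccw a b c); case: (ccw a b d).
Qed.

(* The inner points of a chain are removed one at a time: a closed polygon [W]
   crosses the boundary of a triangle an even number of times. *)
Lemma shortcut_parity (R : realFieldType) (Q : pred (R * R)) (x y : R * R) l W :
  generic Q -> all Q (x :: rcons l y) -> uniq (x :: rcons l y) -> mod2_cycle W ->
  {in W, forall w, [/\ Q w.1, Q w.2, w.1 != w.2 &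
     w.1 \notin x :: rcons l y /\ w.2 \notin x :: rcons l y]} ->
  crossing_parity (steps x (rcons l y)) W = crossing_parity [:: (x, y)] W.
Proof.
move=> gQ + + cW; elim: l x => [|z l IH] x //= /and3P[Qx Qz Ql] /and3P[xl zl ul] HW.
rewrite /crossing_parity big_cons /=.
rewrite [X in _ (+) X](_ : _ = crossing_parity [:: (z, y)] W); last first.
  apply: IH => /=; rewrite ?Qz ?zl //.
  move=> w /HW[-> -> ->]; rewrite !(inE, mem_rcons) !negb_or => -[/and4P[_ -> -> ->] /and4P[_ -> -> ->]].
  by [].
rewrite /crossing_parity !big_cons !big_nil !addbF -big_split /=.
have Qy : Q y by move: Ql; rewrite all_rcons => /andP[].
have -> : \big[addb/false]_(w <- W) (crosses x z w.1 w.2 (+) crosses z y w.1 w.2) =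
    \big[addb/false]_(w <- W) (crosses x y w.1 w.2 (+)
       (in_triangle w.1 x z y (+) in_triangle w.2 x z y)).
  apply: eq_big_seq => -[p q] /HW[/= Qp Qq pq []].
  rewrite !(inE, mem_rcons) !negb_or => /and4P[px pz py _] /and4P[qx qz qy _].
  move: xl zl; rewrite !(inE, mem_rcons) !negb_or => /and3P[xz xy _] /andP[zy _].
  rewrite -(@triangle_parity _ Q x z y p q) //.
  - rewrite -(@crosses_swap _ Q x y p q) //=.
    + by case: (crosses x z p q); case: (crosses z y p q); case: (crosses y x p q).
    + by rewrite Qx Qy Qp Qq.
    + by rewrite !inE !negb_or xy pq !(eq_sym x) !(eq_sym y) px qx py qy.
  - by rewrite /= Qx Qz Qy Qp Qq.
  - by rewrite /= !inE !negb_or xz xy zy pq !(eq_sym x) !(eq_sym z) !(eq_sym y) px qx pz qz py qy.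
by rewrite big_split /= (cW (fun p => in_triangle p x z y)) addbF.
Qed.

(* The three edges of K_5 that are independent of a given edge form a triangle,
   which allows the use of [shortcut_parity]. *)
Lemma K5_crossing (R : realFieldType) (Q : pred (R * R)) (v : nat -> R * R)
    (l : nat * nat -> seq (R * R)) :
  generic Q ->
  {in K5_edges, forall e, all Q (v e.1 :: rcons (l e) (v e.2))} ->
  {in K5_edges, forall e, uniq (v e.1 :: rcons (l e) (v e.2))} ->
  {in K5_edges &, forall e f, independent e f ->
     {in v f.1 :: rcons (l f) (v f.2), forall x, x \notin v e.1 :: rcons (l e) (v e.2)}} ->
  exists e f u w, [/\ e \in K5_edges /\ f \in K5_edges, independent e f,
    u \in steps (v e.1) (rcons (l e) (v e.2)),
    w \in steps (v f.1) (rcons (l f) (v f.2)) & crosses u.1 u.2 w.1 w.2].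
Proof.
move=> gQ QE uE dE.
pose ch e := steps (v e.1) (rcons (l e) (v e.2)).
pose st (e : nat * nat) := [:: (v e.1, v e.2)].
have [/hasP[e eE /hasP[f fE /andP[ef /hasP[u uch /hasP[w wch c]]]]]|no] :=
  boolP (has (fun e => has (fun f => independent e f &&
    has (fun u => has (fun w => crosses u.1 u.2 w.1 w.2) (ch f)) (ch e)) K5_edges) K5_edges).
  by exists e, f, u, w.
have ch0 e f : e \in K5_edges -> f \in K5_edges -> independent e f ->
    crossing_parity (ch e) (ch f) = false.
  move=> eE fE ef; rewrite /crossing_parity big1_seq // => u /andP[_ ue].
  rewrite big1_seq // => w /andP[_ wf]; apply: contraNF no => c.
  apply/hasP; exists e => //; apply/hasP; exists f => //; rewrite ef.
  by apply/hasP; exists u => //; apply/hasP; exists w.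
(* Hybrid drawing: when [e] is straightened, the edges before it are already straight and those
   after it are still polygonal. *)
pose F e f := if edge_lt f e then st f else ch f.
have sub_ends f w : w \in st f -> w.1 \in v f.1 :: rcons (l f) (v f.2) /\
    w.2 \in v f.1 :: rcons (l f) (v f.2).
  by rewrite inE => /eqP-> /=; rewrite mem_head !(inE, mem_rcons) eqxx orbT.
have st_neq f w : f \in K5_edges -> w \in st f -> w.1 != w.2.
  move=> fE; rewrite inE => /eqP-> /=; have := uE f fE.
  by rewrite /= mem_rcons inE negb_or => /andP[/andP[]].
have bnd e f h : \big[addb/false]_(w <- F e f) (h w.1 (+) h w.2) = h (v f.1) (+) h (v f.2).
  by rewrite /F; case: ifP => _; [rewrite big_seq1|rewrite steps_boundary].
have cyc h : {in K5_edges, forall e,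
    \big[addb/false]_(f <- K5_edges | independent e f) (h (v f.1) (+) h (v f.2)) = false}.
  move=> e eE; apply/negbTE; move: e eE; apply/allP.
  by rewrite unlock /=; do 5 case: (h (v _)).
have key : {in K5_edges, forall e,
   \big[addb/false]_(f <- K5_edges | independent e f) crossing_parity (ch e) (F e f) =
   \big[addb/false]_(f <- K5_edges | independent e f) crossing_parity (st e) (F e f)}.
  move=> e eE; pose W := flatten [seq F e f | f <- K5_edges & independent e f].
  have XW s : crossing_parity s W =
      \big[addb/false]_(f <- K5_edges | independent e f) crossing_parity s (F e f).
    rewrite /crossing_parity [RHS]exchange_big /=; apply: eq_bigr => u _.
    by rewrite /W big_flatten big_map big_filter.
  rewrite -!XW; apply: shortcut_parity (QE e eE) (uE e eE) _ _ => //.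
    move=> h; rewrite /W big_flatten big_map big_filter /= -[RHS](cyc h e eE).
    by apply: eq_bigr => f _; apply: bnd.
  move=> w /flattenP[_ /mapP[f + ->]]; rewrite mem_filter => /andP[ef fE] wF.
  have [w1 w2] : w.1 \in v f.1 :: rcons (l f) (v f.2) /\ w.2 \in v f.1 :: rcons (l f) (v f.2).
    by move: wF; rewrite /F; case: ifP => _; [apply: sub_ends|apply: steps_mem].
  have Qf := allP (QE f fE); split; [exact: Qf|exact: Qf| |].
    by move: wF; rewrite /F; case: ifP => _; [apply: st_neq|apply: steps_neq; apply: uE].
  by split; apply: dE w1 || apply: dE w2.
have lt_total : all (fun e => all (fun f =>
    independent e f && ~~ edge_lt f e == independent e f && edge_lt e f) K5_edges) K5_edges.
  by vm_compute.
have split_lt e s (G : nat * nat -> seq ((R * R) * (R * R))) : e \in K5_edges ->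
    \big[addb/false]_(f <- K5_edges | independent e f) crossing_parity s (G f) =
    \big[addb/false]_(f <- K5_edges | independent e f && edge_lt f e) crossing_parity s (G f) (+)
    \big[addb/false]_(f <- K5_edges | independent e f && edge_lt e f) crossing_parity s (G f).
  move=> eE; rewrite (bigID (edge_lt^~ e)) /=; congr (_ (+) _).
  rewrite [LHS]big_seq_cond [RHS]big_seq_cond; apply: eq_bigl => f.
  by case: (boolP (f \in _)) => //= fE; apply/eqP/(allP (allP lt_total e eE)).
pose below (a b : nat * nat -> seq ((R * R) * (R * R))) := \big[addb/false]_(e <- K5_edges)
  \big[addb/false]_(f <- K5_edges | independent e f && edge_lt f e) crossing_parity (a e) (b f).
pose above (a b : nat * nat -> seq ((R * R) * (R * R))) := \big[addb/false]_(e <- K5_edges)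
  \big[addb/false]_(f <- K5_edges | independent e f && edge_lt e f) crossing_parity (a e) (b f).
have flip a b : below a b = above b a.
  rewrite /below (exchange_big_dep predT) //=; apply: eq_bigr => f _.
  apply: eq_big => [e|e _]; last exact: crossing_parityC.
  congr (_ && _); rewrite /independent.
  rewrite -[[:: e.1; e.2; f.1; f.2]]/([:: e.1; e.2] ++ [:: f.1; f.2]) uniq_catC.
  by [].
have ltF e f : edge_lt f e -> edge_lt e f = false.
  by rewrite /edge_lt => h; rewrite ltnNge ltnW.
(* Polygonal edges do not cross, so this is [key] summed over [e]. As [below ch st] is [above st ch]
   by symmetry, [below st st] is even, against [K5_straight_parity]. *)
have sums : below ch st = below st st (+) above st ch.
  rewrite /below /above -big_split /=; apply: eq_big_seq => e eE.
  have := key e eE; rewrite !split_lt // [X in _ (+) X = _]big1_seq ?addbF.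
    move=> h; apply: etrans (etrans _ h) _.
    - by apply: eq_bigr => f /andP[_ fe]; rewrite /F fe.
    - congr (_ (+) _); apply: eq_bigr => f /andP[_ fe]; rewrite /F ?fe //.
      by case: ifP => // /ltF; rewrite fe.
  move=> f /andP[/andP[ef lt] fE]; rewrite /F; case: ifP => [/ltF|_]; first by rewrite lt.
  exact: ch0.
suff : above st st by rewrite -flip; move: sums; rewrite flip; case: (above _ _); case: (below _ _).
have vQ i : (i < 5)%N -> Q (v i).
  have h e : e \in K5_edges -> Q (v e.1) /\ Q (v e.2).
    by move/QE; rewrite /= all_rcons => /and3P[].
  case: i => [|[|[|[|[|//]]]]] _.
  - by have [] := h (0, 1)%N isT.
  - by have [] := h (1, 2)%N isT.
  - by have [] := h (2, 3)%N isT.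
  - by have [] := h (3, 4)%N isT.
  - by have [] := h (0, 4)%N isT.
have vn i j : (i < j < 5)%N -> v i != v j.
  move=> /andP[ij j5]; have eE : (i, j) \in K5_edges.
    by move: j j5 ij => [|[|[|[|[|//]]]]] _; move: i => [|[|[|[|[|//]]]]].
  by have := @st_neq (i, j) (v i, v j) eE; rewrite inE eqxx => /(_ isT).
apply: etrans (K5_straight_parity gQ vQ vn); apply: eq_bigr => e _; apply: eq_bigr => f _.
by rewrite /crossing_parity !big_seq1.
Qed.

(** * General position and approximation by chains *)

Definition box_close (R : realFieldType) (d : R) : rel (R * R) :=
  [rel x y | (`|x.1 - y.1| < d) && (`|x.2 - y.2| < d)].

Lemma box_close_refl (R : realFieldType) (d : R) x : 0 < d -> box_close d x x.
Proof. by move=> d0; rewrite /box_close /= !subrr normr0 d0. Qed.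

Lemma box_close_sym (R : realFieldType) (d : R) x y : box_close d x y = box_close d y x.
Proof. by rewrite /box_close /= distrC (distrC x.2). Qed.

Lemma box_close_trans (R : realFieldType) (c d : R) x y z :
  box_close c x y -> box_close d y z -> box_close (c + d) x z.
Proof.
move=> /andP[h1 h2] /andP[h3 h4]; apply/andP.
by split; apply: le_lt_trans (ler_distD _ _ _) (ltrD _ _); eassumption.
Qed.

Lemma opposite_sign_ratio (R : realFieldType) (x y : R) :
  (0 < x) != (0 < y) -> x - y != 0 /\ 0 <= x / (x - y) <= 1.
Proof.
have unit (a b : R) : 0 < b -> 0 <= a <= b -> 0 <= a / b <= 1.
  move=> b0 /andP[a0 ab]; rewrite divr_ge0 ?(ltW b0) //=.
  by rewrite ler_pdivrMr // mul1r.
case: (ltP 0 x) => hx; case: (ltP 0 y) => hy // _.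
  have xy : 0 < x - y by lra.
  by split; [rewrite gt_eqF|apply: unit => //; lra].
have xy : 0 < y - x by lra.
split; first by rewrite lt_eqF; lra.
by rewrite -mulrNN -invrN opprB; apply: unit => //; lra.
Qed.

(** The segments meet at the parameters [u] on [ab] and [t] on [cd], so [a - c] is a combination of
    [a - b] and [c - d] with coefficients of absolute value at most 1. *)
Lemma crosses_near (R : realFieldType) (a b c d : R * R) (r s : R) :
  crosses a b c d -> box_close r a b -> box_close s c d -> box_close (r + s) a c.
Proof.
move=> /andP[/opposite_sign_ratio[D0 t01] /opposite_sign_ratio[E0 u01]].
move: D0 t01 E0 u01; set D1 := det3 a b c; set D2 := det3 a b d.
set E1 := det3 c d a; set E2 := det3 c d b => D0.
set t := D1 / _ => /andP[t0 t1] E0; set u := E1 / _ => /andP[u0 u1].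
have ht : t * (D1 - D2) = D1 by rewrite divfK.
have hu : u * (D1 - D2) = - E1.
  have -> : D1 - D2 = - (E1 - E2) by rewrite /E1 /E2 /D1 /D2 /det3; ring.
  by rewrite mulrN divfK.
have meet (ai bi ci di : R) :
    (D1 - D2) * (ai - ci) - E1 * (bi - ai) - D1 * (di - ci) = 0 ->
    `|ai - bi| < r -> `|ci - di| < s -> `|ai - ci| < r + s.
  rewrite -[E1]opprK -hu -{3}ht => e abi cdi.
  have -> : ai - ci = u * (ai - bi) - t * (ci - di).
    by apply: (mulfI D0); apply/eqP; rewrite -subr_eq0 -e; apply/eqP; ring.
  apply: le_lt_trans (ler_normB _ _) _; rewrite (normrM u) (normrM t) (ger0_norm t0) (ger0_norm u0).
  apply: ltrD.
    by apply: le_lt_trans abi; rewrite ler_piMl.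
  by apply: le_lt_trans cdi; rewrite ler_piMl.
move=> /andP[ab1 ab2] /andP[cd1 cd2]; apply/andP; split.
  by apply: (meet _ b.1 _ d.1) => //; rewrite /D1 /D2 /E1 /det3; ring.
by apply: (meet _ b.2 _ d.2) => //; rewrite /D1 /D2 /E1 /det3; ring.
Qed.

(** A line meets a parabola in at most two points, so a small move of [t] along this one avoids
    finitely many given lines. *)
Definition on_parabola (R : realFieldType) (t : R * R) (h : R) : R * R := (t.1 + h, t.2 + h ^+ 2).

Lemma avoid_roots (R : realFieldType) (P : {poly R}) (d : R) :
  P != 0 -> 0 < d -> exists2 h, 0 < h < d & P.[h] != 0.
Proof.
move=> P0 d0; pose h k : R := d / (k.+2)%:R.
have hinj : injective h.
  by move=> i j /(mulfI (lt0r_neq0 d0))/invr_inj/eqP; rewrite eqr_nat => /eqP[].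
have [/allP all_root|/allPn[x /mapP[k _ ->] nr]] := boolP (all (root P) (map h (iota 0 (size P)))).
  have := max_poly_roots P0 (introT allP all_root).
  by rewrite map_inj_uniq // iota_uniq size_map size_iota ltnn => /(_ isT).
exists (h k); last exact: nr.
rewrite divr_gt0 ?ltr0n //= ltr_pdivrMr ?ltr0n //.
by rewrite -subr_gt0 -[X in _ - X]mulr1 -mulrBr mulr_gt0 // subr_gt0 ltr1n.
Qed.

Lemma det3_cycle (R : realFieldType) (a b c : R * R) : det3 b c a = det3 a b c.
Proof. by rewrite /det3; ring. Qed.

Lemma generic_point (R : realFieldType) (s : seq (R * R)) (t : R * R) (d : R) :
  0 < d -> exists p, [/\ box_close d t p, p \notin s &
    {in s &, forall a b, a != b -> det3 a b p != 0}].
Proof.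
move=> d0.
(* The determinant as a polynomial in [h]; its coefficients of degree 2 and 1 are, up to sign, the
   coordinates of [u.2 - u.1]. *)
pose q (u : (R * R) * (R * R)) : {poly R} :=
  (u.2.1 - u.1.1) *: ('X^2 + (t.2 - u.1.2)%:P) - (u.2.2 - u.1.2) *: ('X + (t.1 - u.1.1)%:P).
have qE u h : (q u).[h] = det3 u.1 u.2 (on_parabola t h).
  by rewrite /q /det3 !hornerE /=; ring.
pose P := (\prod_(a <- s) ('X - (a.1 - t.1)%:P)) *
          \prod_(u <- [seq u <- [seq (a, b) | a <- s, b <- s] | u.1 != u.2]) q u.
have P0 : P != 0.
  rewrite mulf_neq0 // prodf_seq_neq0; apply/allP => u; rewrite ?polyXsubC_eq0 // mem_filter.
  case/andP=> un _; apply/implyP => _; apply: contraNneq un => q0.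
  have : (q u)`_2 = 0 /\ (q u)`_1 = 0 by rewrite q0 !coef0.
  rewrite /q !(coefE, coefD, coefN, coefZ, coefXn, coefX, coefC) /=.
  move=> [h1 h2]; apply/eqP/injective_projections; apply/eqP; rewrite -subr_eq0; apply/eqP; lra.
(* With [h < 1] the second coordinate [h ^+ 2] also stays below [d]. *)
have m0 : 0 < Num.min d 1 by rewrite lt_min d0 ltr01.
have [h /andP[h0 hm] Ph] := avoid_roots P0 m0.
move: hm; rewrite lt_min => /andP[hd h1].
exists (on_parabola t h); split.
- rewrite /box_close /= !opprD !addrA !subrr !sub0r !normrN gtr0_norm // hd /=.
  rewrite gtr0_norm ?exprn_gt0 //; nra.
- apply: contra Ph => ps; rewrite hornerM horner_prod mulf_eq0 prodf_seq_eq0.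
  apply/orP; left; apply/hasP; exists (on_parabola t h) => //=.
  by rewrite !hornerE /= addrAC subrr add0r subrr.
- move=> a b aS bS ab; apply: contra Ph => /eqP det0.
  rewrite hornerM horner_prod mulf_eq0 [X in _ || (X == 0)]horner_prod.
  apply/orP; right; rewrite prodf_seq_eq0; apply/hasP; exists (a, b).
    by rewrite mem_filter ab; apply/allpairsP; exists (a, b).
  by rewrite /= qE det0.
Qed.

Lemma generic_perturbation (R : realFieldType) (I : eqType) (L : seq I) (t : I -> R * R) (d : R) :
  0 < d -> uniq L -> exists p : I -> R * R,
    [/\ {in L &, injective p}, generic (mem (map p L)) & forall i, i \in L -> box_close d (t i) (p i)].
Proof.
move=> d0; elim: L => [|x L IH] /=; first by exists t.
move=> /andP[xL /IH[p [pinj pg pc]]].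
have [z [zt zp zdet]] := generic_point (map p L) (t x) d0.
pose p' i := if i == x then z else p i; exists p'.
have p'x : p' x = z by rewrite /p' eqxx.
have pp : {in L, p =1 p'}.
  by move=> i iL; rewrite /p'; case: eqP => // ix; rewrite -ix iL in xL.
have mp : map p' L = map p L by apply/esym/eq_in_map.
split.
- have pz i : i \in L -> p' i != z.
    by move=> iL; rewrite -pp //; apply: contraNneq zp => <-; apply: map_f.
  move=> i j; rewrite !inE => /orP[/eqP->|iL] /orP[/eqP->|jL] //; rewrite ?p'x.
  + by move=> e; have := pz j jL; rewrite -e eqxx.
  + by move=> e; have := pz i iL; rewrite e eqxx.
  + by rewrite -!pp //; apply: pinj.
- move=> a b c; rewrite /= p'x mp !inE.
  case/orP=> [/eqP->|aL]; case/orP=> [/eqP->|bL]; case/orP=> [/eqP->|cL]; rewrite ?eqxx // => ab ac bc.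
  + by rewrite -det3_cycle zdet.
  + by rewrite det3_cycle zdet // eq_sym.
  + exact: zdet.
  + exact: pg.
- by move=> i; rewrite inE => /orP[/eqP->|iL]; rewrite ?p'x // -pp // pc.
Qed.

Lemma choose_on_seq (I : eqType) (T : Type) (P : I -> T -> Prop) (s : seq I) (t0 : T) :
  {in s, forall i, exists t, P i t} -> exists f : I -> T, {in s, forall i, P i (f i)}.
Proof.
elim: s => [|x s IH] h; first by exists (fun=> t0).
have [t Pt] := h x (mem_head _ _).
have [f Pf] : exists f : I -> T, {in s, forall i, P i (f i)}.
  by apply: IH => i si; apply: h; rewrite inE si orbT.
exists (fun i => if i == x then t else f i) => i; rewrite inE.
by case: eqP => [->|_] //= /Pf.
Qed.

Lemma steps_path (T : eqType) (r : rel T) x l w :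
  path r x l -> w \in steps x l -> [/\ w.1 \in x :: l, w.2 \in x :: l & r w.1 w.2].
Proof.
elim: l x => //= y l IH x /andP[xy pl]; rewrite inE => /orP[/eqP->|/(IH _ pl)[w1 w2 rw]].
  by rewrite /= !inE !eqxx orbT.
by split=> //; rewrite in_cons; apply/orP; right.
Qed.

Lemma steps_map (T T' : Type) (f : T -> T') x l :
  steps (f x) (map f l) = [seq (f u.1, f u.2) | u <- steps x l].
Proof. by elim: l x => //= y l IH x; rewrite IH. Qed.

(** After a perturbation into general position, [K5_crossing] gives crossing segments on independent
    edges; short segments that cross have close ends, against the separation. *)
Lemma K5_separated_chains (R : realFieldType) (d : R) (b : nat -> R * R)
    (K : nat * nat -> R * R -> Prop) :
  0 < d ->
  (forall e, e \in K5_edges -> forall r, 0 < r -> exists s,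
     [/\ path (box_close r) (b e.1) s, last (b e.1) s = b e.2 &
         forall z, z \in b e.1 :: s -> K e z]) ->
  (forall e f x y, e \in K5_edges -> f \in K5_edges -> independent e f ->
     K e x -> K f y -> ~~ box_close d x y) ->
  False.
Proof.
(* Perturbed segments are shorter than [3 * r] and points move by less than [r]: a crossing brings
   two original points within [r + 3 * r + 3 * r + r]. *)
move=> d0 chains sep; pose r := d / 8%:R.
have r0 : 0 < r by rewrite divr_gt0 // ltr0n.
have [S HS] := @choose_on_seq _ _ _ _ [::] (fun e eE => chains e eE r r0).
pose M := (\max_(e <- K5_edges) size (S e))%N.
(* Repeating the last point gives all chains the same length. The perturbation acts on indices, so
   repeated points become distinct, while the five vertices remain shared by their edges. *)
pose S' e := S e ++ nseq (M.+1 - size (S e)) (b e.2).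
have szS e : e \in K5_edges -> (size (S e) <= M)%N.
  by move=> eE; apply: leq_bigmax_seq.
have sz' e : e \in K5_edges -> size (S' e) = M.+1.
  by move=> eE; rewrite size_cat size_nseq subnKC // leqW // szS.
have HS' e : e \in K5_edges -> [/\ path (box_close r) (b e.1) (S' e),
    S' e = rcons (take M (S' e)) (b e.2) & forall z, z \in b e.1 :: S' e -> K e z].
  move=> eE; have [pS lS KS] := HS e eE.
  have Kb2 : K e (b e.2) by apply: KS; rewrite -lS mem_last.
  have lS' : last (b e.1) (S' e) = b e.2.
    by rewrite last_cat lS; elim: (_ - _)%N.
  split.
  - rewrite cat_path pS lS /=; elim: (_ - _)%N => //= n ->.
    by rewrite box_close_refl.
  - case/lastP: (S' e) (sz' e eE) lS' => // u z; rewrite size_rcons last_rcons => -[su] ->.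
    by congr rcons; rewrite -cats1 take_size_cat.
  - move=> z; rewrite inE mem_cat mem_nseq orbA => /orP[h|/andP[_ /eqP->]] //.
    by apply: KS; rewrite inE.
pose I := (nat + (nat * nat) * nat)%type.
pose t (i : I) := match i with inl j => b j | inr (e, m) => nth (b e.2) (S' e) m end.
pose L : seq I := [seq inl j | j <- iota 0 5] ++ [seq inr (e, m) | e <- K5_edges, m <- iota 0 M].
have uL : uniq L.
  rewrite cat_uniq map_inj_uniq ?iota_uniq; last by move=> i j [].
  rewrite allpairs_uniq ?iota_uniq //; last by move=> [e m] [e' m'] _ _ [-> ->].
  rewrite andbT; apply/hasPn => _ /allpairsP[u [_ _ ->]].
  by apply/mapP => -[].
have [p [pinj pg pc]] := generic_perturbation t r0 uL.
pose inner (e : nat * nat) : seq I := [seq inr (e, m) | m <- iota 0 M].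
pose vi j : I := inl j.
have idxL e : e \in K5_edges -> {subset vi e.1 :: rcons (inner e) (vi e.2) <= L}.
  move=> eE i; rewrite inE mem_rcons inE mem_cat.
  have ends : ((e.1 < 5) && (e.2 < 5))%N.
    by apply: (allP (a := fun e => (e.1 < 5) && (e.2 < 5))%N _ e eE).
  have vL j : (j < 5)%N -> vi j \in [seq inl j | j <- iota 0 5].
    by move=> j5; apply: map_f; rewrite mem_iota.
  have [e1 e2] := andP ends.
  case/or3P=> [/eqP->|/eqP->|/mapP[m mM ->]]; rewrite ?vL //.
  by apply/orP; right; apply/allpairsP; exists (e, m).
have ti e : e \in K5_edges -> map t (rcons (inner e) (vi e.2)) = S' e.
  move=> eE; have [_ -> _] := HS' e eE; rewrite map_rcons; congr rcons.
  by rewrite -map_comp -[in RHS](map_nth_iota0 (b e.2)) ?sz'.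
have path_t e : e \in K5_edges ->
    path (relpre t (box_close r)) (vi e.1) (rcons (inner e) (vi e.2)).
  by move=> eE; rewrite -path_map ti //; have [] := HS' e eE.
have K_t e i : e \in K5_edges -> i \in vi e.1 :: rcons (inner e) (vi e.2) -> K e (t i).
  move=> eE ie; have [_ _] := HS' e eE; apply; rewrite -ti // -[b e.1]/(t (vi e.1)) -map_cons.
  exact: map_f.
pose v j := p (vi j); pose l e := map p (inner e).
have lE e : v e.1 :: rcons (l e) (v e.2) = map p (vi e.1 :: rcons (inner e) (vi e.2)).
  by rewrite /= map_rcons.
have uidx e : e \in K5_edges -> uniq (vi e.1 :: rcons (inner e) (vi e.2)).
  move=> eE; have ne : e.1 != e.2 by apply: (allP (a := fun e => e.1 != e.2) _ e eE).
  rewrite /= mem_rcons inE rcons_uniq map_inj_uniq ?iota_uniq; last by move=> i j [].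
  rewrite negb_or andbT -!andbA; apply/and3P; split.
  - by apply: contra ne => /eqP[->].
  - by apply/mapP => -[].
  - by apply/mapP => -[].
have in_idx e i : i \in vi e.1 :: rcons (inner e) (vi e.2) ->
    match i with inl j => (j == e.1) || (j == e.2) | inr (e', _) => e' == e end.
  rewrite inE mem_rcons inE => /or3P[/eqP->|/eqP->|/mapP[m _ ->]] /=; rewrite ?eqxx ?orbT //.
have [|e eE|e eE|e f eE fE ef x|e [f [u [w [[eE fE] ef ue wf c]]]]] :=
  @K5_crossing _ (mem (map p L)) v l.
- exact: pg.
- by rewrite lE; apply/allP => _ /mapP[i ie ->]; apply: map_f; apply: idxL ie.
- rewrite lE map_inj_in_uniq ?uidx // => i j ie je; apply: pinj; exact: idxL je || exact: idxL ie.
- rewrite !lE => /mapP[i jf ->]; apply/negP => /mapP[j ie /pinj].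
  rewrite (idxL f fE) // (idxL e eE) // => /(_ isT isT) ij; rewrite ij in jf.
  move: ef (in_idx _ _ ie) (in_idx _ _ jf); rewrite /independent /= !inE !negb_or -!andbA.
  move=> /and5P[ee e1f1 e1f2 e2f1 /and3P[e2f2 _ _]].
  case: j {ie jf ij} => [j|[e' m]].
    by case/orP=> /eqP->; rewrite ?(negPf e1f1) ?(negPf e1f2) ?(negPf e2f1) ?(negPf e2f2).
  by move=> /eqP-> /eqP h; rewrite h eqxx in e1f1.
- move: ue wf c; rewrite /v /l -!map_rcons !steps_map => /mapP[u' ue ->] /mapP[w' wf ->] /= c.
  have [u1 u2 uu] := steps_path (path_t e eE) ue.
  have [w1 w2 ww] := steps_path (path_t f fE) wf.
  have near i : i \in L -> box_close r (p i) (t i) by move=> iL; rewrite box_close_sym pc.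
  have long g i j : g \in K5_edges -> i \in vi g.1 :: rcons (inner g) (vi g.2) ->
      j \in vi g.1 :: rcons (inner g) (vi g.2) -> box_close r (t i) (t j) ->
      box_close (r + (r + r)) (p i) (p j).
    move=> gE ig jg tij; apply: box_close_trans (near _ (idxL g gE _ ig)) _.
    exact: box_close_trans tij (pc _ (idxL g gE _ jg)).
  have cl := crosses_near c (long e _ _ eE u1 u2 uu) (long f _ _ fE w1 w2 ww).
  have := sep e f _ _ eE fE ef (K_t e _ eE u1) (K_t f _ fE w1).
  have -> : d = r + ((r + (r + r) + (r + (r + r))) + r).
    by rewrite /r; field.
  case/negP; apply: box_close_trans (pc _ (idxL e eE _ u1)) _.
  exact: box_close_trans cl (near _ (idxL f fE _ w1)).
Qed.

From mathcomp Require Import all_classical all_reals all_analysis.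
Import numFieldNormedType.Exports.

(** * Planar drawings *)

Local Open Scope classical_set_scope.

(** Compactness as a near covering: [e] bounds both the neighbourhood of [t] and the admissible [d],
    so one [d] serves the whole interval. *)
Lemma unit_interval_uniform (R : realType) (P : R -> R -> Prop) :
  (forall t : R, 0 <= t <= 1 -> exists2 e : R, 0 < e &
     forall t' d : R, 0 <= t' <= 1 -> `|t - t'| < e -> 0 < d < e -> P d t') ->
  exists2 d : R, 0 < d & forall t : R, 0 <= t <= 1 -> P d t.
Proof.
move=> loc; have /compact_near_coveringP/near_covering_withinP cov := @segment_compact R 0 1.
have near_d : \forall d \near 0^'+, `[0, 1]%classic `<=` P d.
  apply: cov => t; rewrite /= in_itv /= => t01; have [e e0 he] := loc t t01.
  exists (ball t e, [set d | 0 < d < e]) => /=.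
    split; first exact: nbhsx_ballx.
    by near=> d; apply/andP; split; near: d; [exact: nbhs_right_gt|exact: nbhs_right_lt].
  by move=> [t' d] /= [tt' de]; rewrite in_itv /= => t'01; apply: he.
have [d [Pd d0]] : exists d, `[0, 1]%classic `<=` P d /\ 0 < d.
  near (0 : R)^'+ => d; exists d; split; near: d; [exact: near_d|exact: nbhs_right_gt].
by exists d => // t t01; apply: Pd; rewrite /= in_itv.
Unshelve. all: by end_near.
Qed.

Definition box_continuous (R : realType) (f : R -> R * R) : Prop :=
  forall t e : R, 0 <= t <= 1 -> 0 < e -> exists2 d : R, 0 < d &
    forall s : R, 0 <= s <= 1 -> `|t - s| < d -> box_close e (f t) (f s).

Lemma within_box_continuous (R : realType) (f : R -> R * R) :
  {within `[0, 1], continuous f} -> box_continuous f.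
Proof.
move=> /subspace_continuousP cf t e t01 e0.
have tin : `[0, 1]%classic t by rewrite /= in_itv.
have := cf t tin _ (nbhsx_ballx (f t) e e0).
rewrite /= nbhs_simpl /= => /nbhs_ballP[d /= d0 h]; exists d => // s s01 ts.
by have := h s ts; rewrite in_itv /= s01 => /(_ isT)[b1 b2]; apply/andP.
Qed.

Lemma box_uniform (R : realType) (f : R -> R * R) (e : R) :
  box_continuous f -> 0 < e -> exists2 d : R, 0 < d &
    forall t s : R, 0 <= t <= 1 -> 0 <= s <= 1 -> `|t - s| < d -> box_close e (f t) (f s).
Proof.
move=> cf e0.
have e2 : 0 < e / 2 by rewrite divr_gt0.
have [|d d0 h] := @unit_interval_uniform R (fun d t => forall s : R, 0 <= s <= 1 ->
    `|t - s| < d -> box_close e (f t) (f s)).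
  move=> t t01; have [d d0 h] := cf t _ t01 e2; exists (d / 2); first by rewrite divr_gt0.
  move=> t' d' t'01 tt' /andP[_ d'd] s s01 t's.
  rewrite (splitr e); apply: box_close_trans (_ : box_close _ _ (f t)) _.
    by rewrite box_close_sym h // (lt_trans tt') // ltr_pdivrMr // ltr_pMr // ltr1n.
  apply: h => //; rewrite (splitr d); apply: le_lt_trans (ler_distD t' _ _) _.
  by rewrite ltrD // (lt_trans t's).
by exists d => // t s t01 s01; apply: h.
Qed.

Lemma arc_chain (R : realType) (a b : R * R) (K : set (R * R)) (r : R) :
  is_arc a b K -> 0 < r -> exists s,
    [/\ path (box_close r) a s, last a s = b & forall z, z \in a :: s -> K z].
Proof.
move=> [f [/within_box_continuous cf _ fa fb ->]] r0.
have [d d0 unif] := box_uniform cf r0.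
pose n := (Num.bound d^-1).+1.
have n0 : 0 < n%:R :> R by rewrite ltr0n.
have nd : n%:R^-1 < d.
  rewrite -[d]invrK ltf_pV2 ?posrE ?invr_gt0 //.
  apply: lt_trans (archi_boundP _) _; first by rewrite invr_ge0 ltW.
  by rewrite ltr_nat.
have in01 k : (k <= n)%N -> 0 <= (k%:R / n%:R : R) <= 1.
  move=> kn; apply/andP; split; first by rewrite divr_ge0 ?ler0n.
  by rewrite ler_pdivrMr // mul1r ler_nat.
have imf k : (k <= n)%N -> (f @` `[0, 1]%classic) (f (k%:R / n%:R)).
  by move=> kn; exists (k%:R / n%:R) => //=; rewrite in_itv /= in01.
exists (mkseq (fun k => f (k.+1%:R / n%:R)) n); split.
- apply/(pathP (0, 0)) => i; rewrite size_mkseq => i_n.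
  have -> : nth (0, 0) (a :: mkseq (fun k => f (k.+1%:R / n%:R)) n) i = f (i%:R / n%:R).
    by case: i i_n => [|i] i_n; rewrite /= ?nth_mkseq ?mul0r // ltnW.
  rewrite nth_mkseq //; apply: unif; rewrite ?in01 // 1?ltnW //.
  by rewrite -mulrBl -natr1 opprD addrA subrr sub0r mulN1r normrN gtr0_norm ?invr_gt0.
- rewrite -nth_last size_mkseq nth_mkseq // -[n.-1.+1]/n divff //.
  by rewrite gt_eqF.
- move=> z; rewrite inE => /orP[/eqP->|/(nthP (0, 0))[i]].
    by have := imf 0%N isT; rewrite mul0r fa.
  by rewrite size_mkseq => i_n; rewrite nth_mkseq // => <-; apply: imf.
Qed.

(** Compactness is used once for each parameter: at a fixed point of [K] first, then uniformly along
    [K]. *)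
Lemma arcs_separated (R : realType) (a b c d : R * R) (K K' : set (R * R)) :
  is_arc a b K -> is_arc c d K' -> K `&` K' = set0 ->
  exists2 r : R, 0 < r & forall x y, K x -> K' y -> ~~ box_close r x y.
Proof.
move=> [f [/within_box_continuous cf _ _ _ ->]] [g [/within_box_continuous cg _ _ _ ->]] dis.
have ne t s : 0 <= t <= 1 -> 0 <= s <= 1 -> f t <> g s.
  move=> t01 s01 fg; suff : (set0 : set (R * R)) (f t) by [].
  by rewrite -dis; split; [exists t|exists s]; rewrite //= in_itv.
have point (x y : R * R) : x <> y -> exists2 r : R, 0 < r & ~~ box_close r x y.
  move=> xy; have [x1|x1] := eqVneq x.1 y.1; last first.
    exists `|x.1 - y.1|; first by rewrite normr_gt0 subr_eq0.
    by rewrite /box_close /= ltxx.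
  have [x2|x2] := eqVneq x.2 y.2; last first.
    exists `|x.2 - y.2|; first by rewrite normr_gt0 subr_eq0.
    by rewrite /box_close /= ltxx andbF.
  by case: xy; apply: injective_projections.
have half (r : R) : 0 < r -> 0 < r / 2 by move=> r0; rewrite divr_gt0.
have box_close_le (r r' : R) x y : r <= r' -> box_close r x y -> box_close r' x y.
  by move=> rr' /andP[h1 h2]; rewrite /box_close /= (lt_le_trans h1) // (lt_le_trans h2).
have sep1 t : 0 <= t <= 1 -> exists2 r : R, 0 < r & forall s : R, 0 <= s <= 1 -> ~~ box_close r (f t) (g s).
  move=> t01; apply: (@unit_interval_uniform R (fun r s => ~~ box_close r (f t) (g s))) => s s01.
  have [r r0 nr] := point _ _ (ne t s t01 s01).
  have [d' d'0 h] := cg s _ s01 (half r r0).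
  exists (Num.min d' (r / 2)); first by rewrite lt_min d'0 half.
  move=> s' r' s'01; rewrite !lt_min => /andP[ss' _] /andP[_ /andP[_ r'r]].
  apply: contra nr => c1; rewrite (splitr r).
  apply: box_close_trans (box_close_le _ _ _ _ (ltW r'r) c1) _.
  by rewrite box_close_sym h.
have [|r r0 h] := @unit_interval_uniform R (fun r t => forall s : R, 0 <= s <= 1 -> ~~ box_close r (f t) (g s)).
  move=> t t01; have [r r0 nr] := sep1 t t01.
  have [d' d'0 h] := cf t _ t01 (half r r0).
  exists (Num.min d' (r / 2)); first by rewrite lt_min d'0 half.
  move=> t' r' t'01; rewrite !lt_min => /andP[tt' _] /andP[_ /andP[_ r'r]] s s01.
  apply: contra (nr s s01) => c1; rewrite (splitr r).
  by apply: box_close_trans (h _ t'01 tt') (box_close_le _ _ _ _ (ltW r'r) c1).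
exists r => // _ _ [t + <-] [s + <-]; rewrite /= !in_itv /= => t01 s01.
exact: h.
Qed.

Lemma uniform_positive (R : realType) (I : finType) (P : I -> R -> Prop) :
  (forall i r r', r' <= r -> P i r -> P i r') ->
  (forall i, exists2 r : R, 0 < r & P i r) -> exists2 r : R, 0 < r & forall i, P i r.
Proof.
move=> mono h; have /choice[f fP] : forall i, exists r, 0 < r /\ P i r.
  by move=> i; have [r ? ?] := h i; exists r.
exists (\big[Num.min/1]_i f i).
  by apply: lt_bigmin => // i _; have [] := fP i.
by move=> i; apply: mono (fP i).2; apply: bigmin_le_cond.
Qed.

Lemma walk_chain (R : realType) (G : sgraph) (pos : G -> R * R)
    (E : G -> G -> set (R * R)) (U : {set G}) x p (r : R) :
  (forall x y, adj x y -> is_arc (pos x) (pos y) (E x y)) -> 0 < r ->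
  path (restr (@adj G) U) x p -> exists s,
    [/\ path (box_close r) (pos x) s, last (pos x) s = pos (last x p) &
        forall z, z \in s -> exists u w, [/\ u \in U, w \in U, adj u w & E u w z]].
Proof.
move=> arcE r0; elim: p x => [|y p IH] x /=; first by exists [::].
case/andP=> /and3P[xU yU xy] /IH[s [ps ls Ks]].
have [s' [ps' ls' Ks']] := arc_chain (arcE x y xy) r0.
exists (s' ++ s); split.
- by rewrite cat_path ps' ls'.
- by rewrite last_cat ls'.
- move=> z; rewrite mem_cat => /orP[zs|]; last exact: Ks.
  by exists x, y; split=> //; apply: Ks'; rewrite inE zs orbT.
Qed.

Local Close Scope classical_set_scope.

(** Arcs of disjoint edges do not meet: interiors by the last condition of a drawing, ends because a
    vertex lies on no arc of which it is not an end. Finitely many pairs of edges then have a common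
    distance [d]. *)
Lemma disjoint_edges_separated (R : realType) (G : sgraph) (pos : G -> R * R)
    (E : G -> G -> set (R * R)) : plane_drawing pos E ->
  exists2 d : R, 0 < d & forall x y u v, adj x y -> adj u v ->
    [disjoint [set x; y]%SET & [set u; v]%SET] ->
    forall z w, E x y z -> E u v w -> ~~ box_close d z w.
Proof.
move=> [posI arcE _ clear dis].
pose P (q : (G * G) * (G * G)) (d : R) := adj q.1.1 q.1.2 -> adj q.2.1 q.2.2 ->
  [disjoint [set q.1.1; q.1.2]%SET & [set q.2.1; q.2.2]%SET] ->
  forall z w, E q.1.1 q.1.2 z -> E q.2.1 q.2.2 w -> ~~ box_close d z w.
have [|[[x y] [u v]]|d d0 Pd] := @uniform_positive R _ P.
- move=> q r r' rr' Pr xy uv d z w Ez Ew; apply: contra (Pr xy uv d z w Ez Ew).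
  by move=> /andP[h1 h2]; rewrite /box_close /= (lt_le_trans h1) // (lt_le_trans h2).
- have [xy|nxy] := boolP (adj x y); last by exists 1 => // xy; rewrite xy in nxy.
  have [uv|nuv] := boolP (adj u v); last by exists 1 => // _ uv; rewrite uv in nuv.
  have [d|nd] := boolP [disjoint [set x; y]%SET & [set u; v]%SET]; last first.
    by exists 1 => // _ _ d; rewrite d in nd.
  have off a : a \in [set x; y]%SET -> ~ E u v (pos a).
    move=> ain Ea; apply: (clear u v a uv); split=> //=.
    have := disjointFr d ain; rewrite finset.in_set2.
    by move=> + [] /posI h; rewrite h eqxx ?orbT.
  have neq : [set x; y]%SET <> [set u; v]%SET :> {set G}.
    move=> e; move: d; rewrite e -setI_eq0 finset.setIid => /eqP h.
    have : u \in (finset.set0 : {set G}) by rewrite -h finset.set21.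
    by rewrite finset.in_set0.
  have Edis : (E x y `&` E u v = set0)%classic.
    apply/seteqP; split=> // z [Exy Euv].
    have := dis x y u v xy uv neq => /seteqP[+ _]; apply; split; [split=> //|exact: Euv].
    by case=> /= h; rewrite h in Euv; [apply: (off x) Euv|apply: (off y) Euv]; rewrite ?finset.set21 ?finset.set22.
  have [r r0 sep] := arcs_separated (arcE x y xy) (arcE u v uv) Edis.
  by exists r => // _ _ _; apply: sep.
exists d => // x y u v xy uv dd; exact: (Pd ((x, y), (u, v))).
Qed.

(** The edge [ij] of K_5 is drawn along a path inside [B i :|: B j]. Independent edges use disjoint
    vertex sets, so their arcs are uniformly separated. *)
Lemma planar_no_K5_minor (R : realType) (G : sgraph) :
  planar R G -> ~ clique_minor (@adj G) [set: G]%SET 5.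
Proof.
move=> [pos [E dr]] [B [B1 B2 B3]].
have [posI arcE _ _ _] := dr.
have [d d0 sep] := disjoint_edges_separated dr.
have [x0 _] : exists x, x \in B 0%N by apply/set0Pn; have [] := B1 0%N isT.
have [b bB] : exists b : nat -> G, {in iota 0 5, forall i, b i \in B i}.
  apply: (@choose_on_seq _ _ (fun i x => x \in B i)) => // i.
  by rewrite mem_iota => /= i5; apply/set0Pn; have [] := B1 i i5.
pose U (e : nat * nat) : {set G} := (B e.1 :|: B e.2)%SET.
pose K e z := exists u w, [/\ u \in U e, w \in U e, adj u w & E u w z].
have K5P e : e \in K5_edges -> [/\ (e.1 < 5)%N, (e.2 < 5)%N & e.1 != e.2].
  by move=> eE; apply/and3P; apply: (allP (a := fun e => [&& (e.1 < 5)%N, (e.2 < 5)%N & e.1 != e.2]) _ e eE).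
have bi i : (i < 5)%N -> b i \in B i by move=> i5; apply: bB; rewrite mem_iota.
apply: (@K5_separated_chains R d (pos \o b) K d0).
- move=> e eE r r0; have [e1 e2 e12] := K5P e eE.
  have [_ _ c1] := B1 _ e1; have [_ _ c2] := B1 _ e2.
  have [u [w [uB wB uw]]] := B3 _ _ e1 e2 e12.
  have : connect (restr (@adj G) (U e)) (b e.1) (b e.2).
    apply: connect_trans (restr_sub (finset.subsetUl _ _) (c1 _ _ (bi _ e1) uB)) _.
    apply: connect_trans (restr_sub (finset.subsetUr _ _) (c2 _ _ wB (bi _ e2))).
    by apply: connect1; rewrite /restr /= !finset.in_setU uB wB orbT uw.
  case/connectP=> p pp lp; have [s [ps ls Ks]] := walk_chain arcE r0 pp.
  exists s; split=> //; first by rewrite ls -lp.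
  move=> z; rewrite inE => /orP[/eqP->|/Ks//] /=.
  case: p pp lp {ps ls Ks} => [_ /= be|y p /= /andP[/and3P[xU yU xy] _] _].
    have := disjointFr (B2 _ _ e1 e2 e12) (bi _ e1).
    by rewrite -be bi.
  exists (b e.1), y; split=> //.
  by have [f [_ _ f0 _ ->]] := arcE _ _ xy; exists 0; rewrite //= in_itv /= lexx ler01.
- move=> e f x y eE fE ef [u [w [uU wU uw Ex]]] [u' [w' [uU' wU' uw' Ey]]].
  have [e1 e2 _] := K5P e eE; have [f1 f2 _] := K5P f fE.
  move: ef; rewrite /independent /= !inE !negb_or -!andbA.
  move=> /and5P[_ e1f1 e1f2 e2f1 /and3P[e2f2 _ _]].
  have dU : [disjoint U e & U f].
    rewrite disjoint_subset; apply/fintype.subsetP => z.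
    rewrite finset.in_setU [z \in [predC _]]inE finset.in_setU negb_or.
    by case/orP=> zB; apply/andP; split; apply/negbT; apply: disjointFr zB; apply: B2.
  apply: (sep u w u' w') => //; apply: disjointWl (disjointWr _ dU).
    by apply/fintype.subsetP => v; rewrite finset.in_set2 => /orP[]/eqP->.
  by apply/fintype.subsetP => v; rewrite finset.in_set2 => /orP[]/eqP->.
Qed.

(** * Bounds for the fractional domatic number *)

Lemma ratio_le_cnbhd (R : realType) (G : sgraph) (v : G) r :
  domatic_ratios R G r -> r <= #|cnbhd v|%:R.
Proof.
move=> [p [q [phi [[/andP[q0 _] phiq dom] ->]]]].
rewrite ler_pdivrMr ?ltr0n // -natrM ler_nat -[p in (p <= _)%N]card_ord -cardsT -(dom v).
rewrite -sum_nat_const; elim/big_ind2: _ => [|m A n B Am Bn|u _]; first by rewrite finset.cards0.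
  by rewrite (leq_trans (leq_of_leqif (finset.leq_card_setU A B))) ?leq_add.
by rewrite phiq.
Qed.

Lemma card_cnbhd (G : sgraph) (v : G) :
  #|cnbhd v| = (deg_in (@adj G) [set: G]%SET v).+1.
Proof.
rewrite /cnbhd finset.cardsU1 finset.in_set adj_irr add1n /deg_in; congr _.+1.
by apply: eq_card => u; rewrite !finset.in_set.
Qed.

Lemma fdom_le_degree (R : realType) (G : sgraph) (v : G) n :
  (deg_in (@adj G) [set: G]%SET v <= n)%N -> fdom R G <= n.+1%:R.
Proof.
move=> dv; apply: ge_sup.
  by apply: (domatic_ratios_has_sup R _).1; apply/card_gt0P; exists v.
move=> r /(ratio_le_cnbhd v) h; apply: le_trans h _.
by rewrite ler_nat card_cnbhd.
Qed.

Lemma fdom_ge0 (R : realType) (G : sgraph) : (0 < #|G|)%N -> 0 <= fdom R G.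
Proof.
move=> /(domatic_ratios_has_sup R)[[r Gr] ub].
have [p [q [_ [_ rE]]]] := Gr.
by apply: le_trans (ub_le_sup ub Gr); rewrite rE divr_ge0.
Qed.

Lemma partial_domatic_fdom (R : realType) (G : sgraph) p q (phi : G -> {set 'I_p}) :
  (0 < #|G|)%N -> (0 < q <= p)%N ->
  (forall v, (2 <= deg_in (@adj G) [set: G]%SET v)%N) ->
  partial_domatic (@adj G) [set: G]%SET q phi -> p%:R / q%:R <= fdom R G.
Proof.
move=> G0 qp dG [p1 p2 _]; have [_ ub] := domatic_ratios_has_sup R G0.
apply: ub_le_sup => //; exists p, q, phi; split=> //; split=> // v.
  by apply: p1; rewrite finset.in_setT.
apply/finset.setP => c; rewrite finset.in_setT; apply/finset.bigcupP.
have [cv|[u [_ vu cu]]] := p2 v (finset.in_setT _) (dG v) c.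
  by exists v => //; rewrite finset.setU11.
by exists u => //; rewrite finset.in_setU finset.in_set vu orbT.
Qed.

Theorem theorem3 (R : realType) :
  exists C : R, 0 < C /\
    forall (g : nat) (G : sgraph),
      (3 <= g)%N -> planar R G -> min_degree_geq G 2 -> girth_geq G g ->
      `|fdom R G - 3%:R| <= C / g%:R.
Proof.
exists (40 * 4610)%:R; split; first by rewrite ltr0n.
move=> g G g3 pl [G0 dG] girth.
have es := @adj_sym G; have ei := @adj_irr G.
have g0 : 0 < g%:R :> R by rewrite ltr0n; apply: leq_trans g3.
have degE v : deg_in (@adj G) [set: G]%SET v = #|nbhd v|.
  by apply: eq_card => u; rewrite !finset.in_set.
have minor := planar_no_K5_minor pl.
have V0 : [set: G]%SET != finset.set0 by rewrite -card_gt0 cardsT.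
(* [4608 = 256 * 18], so that [256 * (18 * k) + 2 < g]. *)
pose k := ((g - 3) %/ 4608)%N.
have [k0|k0] := posnP k.
  (* For [k = 0] the girth bound [g] is at most 4610 and a crude estimate suffices: a vertex of
     degree at most 31 exists, so [fdom] is between 0 and 32. *)
  have [v dv] : exists v : G, (deg_in (@adj G) [set: G]%SET v <= 31)%N.
    apply: contrapT => no; apply: minor; apply: mader es ei V0 _.
    rewrite mulnC -sum_nat_const; apply: leq_sum => v _.
    by rewrite ltnNge; apply/negP => dv; apply: no; exists v.
  have h1 := fdom_le_degree R dv; have h2 := fdom_ge0 R G0.
  have h3 : g%:R <= 4610%:R :> R by rewrite ler_nat; move: k0; rewrite /k; lia.
  rewrite ler_pdivlMr //; apply: le_trans (_ : 32%:R * 4610%:R <= _); last by rewrite -natrM ler_nat leq_mul.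
  apply: ler_pM => //; rewrite ler_norml; lra.
have thr (S : {set G}) : S != finset.set0 -> {in S, forall x, (2 <= deg_in (@adj G) S x)%N} ->
    exists s, [/\ size s = (18 * k)%N, uniq s, sorted (@adj G) s &
             {in s, forall x, x \in S /\ deg_in (@adj G) S x = 2}].
  move=> S0 dS; have [||//|//] := @thread_or_clique_minor G (@adj G) S g (18 * k) es ei girth S0 dS.
  - by rewrite muln_gt0.
  - by move: k0; rewrite /k; lia.
  by move=> m; case: minor; apply: clique_minor_sub m; apply: finset.subsetT.
have dT : {in [set: G]%SET, forall v, (2 <= deg_in (@adj G) [set: G]%SET v)%N}.
  by move=> v _; rewrite degE.
(* A thread of the whole graph provides the vertex of degree 2 for the upper bound. *)
have [s [ss _ _ sG]] := thr _ V0 dT.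
have [v vs] : exists v, v \in s.
  by case: s ss {sG} => [|v s _]; [move=> /= h; move: k0; lia|exists v; rewrite mem_head].
have [_ dv] := sG v vs.
have up : fdom R G <= 3%:R by apply: (@fdom_le_degree R G v 2); rewrite dv.
have [|phi pd] := @partial_domatic_exists G 'I_(3 * k - 1) (@adj G) k [set: G]%SET es ei k0 _ (fun S _ => thr S).
  by rewrite card_ord; move: k0; lia.
have low := partial_domatic_fdom R G0 _ _ pd.
have {low} low : (3 * k - 1)%N%:R / k%:R <= fdom R G.
  by apply: low => [|u]; [move: k0; lia|rewrite degE].
have k0' : 0 < k%:R :> R by rewrite ltr0n.
(* The deficit is [1 / k], which is of order [1 / g] by the choice of [k]. *)
have lowE : (3 * k - 1)%N%:R / k%:R = 3%:R - k%:R^-1 :> R.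
  by rewrite natrB ?muln_gt0 // natrM mulrBl mulfK ?gt_eqF // mul1r.
have gk : g%:R <= (40 * 4610)%:R * k%:R :> R by rewrite -natrM ler_nat; move: k0; rewrite /k; lia.
have inv : k%:R^-1 <= (40 * 4610)%:R / g%:R :> R.
  by rewrite ler_pdivlMr // mulrC ler_pdivrMr.
rewrite lowE in low; rewrite ler_norml; apply/andP; split; lra.
Qed.
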